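(* Let $p$ be a prime number and let $f(x)\in\mathbb{Z}[x]$ be a monic irreducible polynomial, $\theta$ a root of $f(x)$ in an algebraic closure of $\mathbb{Q}$, $K=\mathbb{Q}(\theta)$ and $\mathbb{Z}_K$ its ring of integers. Let $\phi_1(x),\dots,\phi_t(x)\in\mathbb{Z}[x]$ be monic polynomials whose reductions modulo $p$ are the different irreducible factors of $f(x)$ modulo $p$, so that $f(x)\equiv \phi_1(x)^{\ell_1}\cdots\phi_t(x)^{\ell_t}\pmod p$ with $\ell_i\ge 1$, and put $m_i=\deg\phi_i$. For $1\le i\le t$, $1\le j\le \ell_i$, $0\le k<m_i$, let $q_{i,j}(x)\in\mathbb{Z}[x]$ be the quotient of the division of $f(x)$ by $\phi_i(x)^j$, let $\alpha_{i,j,k}=q_{i,j}(\theta)\,\theta^k$, and let $y_{i,j}\in\mathbb{Q}$ be the ordinate of the point of abscissa $j$ on the principal Newton polygon $N_{\phi_i}^-(f)$. If $f(x)$ is $p$-regular with respect to $\phi_1,\dots,\phi_t$, then the family of all elements $$\frac{\alpha_{i,j,k}}{p^{\lfloor y_{i,j}\rfloor}},\qquad 1\le i\le t,\ 1\le j\le \ell_i,\ 0\le k<m_i,$$ is a $p$-integral basis of $\mathbb{Z}_K$.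
   Context: $v_p$ is the $p$-adic valuation, $v_p(p)=1$, extended to polynomials by $v_p(\sum_i c_ix^i)=\min_i v_p(c_i)$. $\mathbb{Z}_{(p)}$ is the localization of $\mathbb{Z}$ at $p$. A $p$-integral basis of $\mathbb{Z}_K$ is a family of elements of $K$ that is a $\mathbb{Z}_{(p)}$-basis of $\mathbb{Z}_K\otimes_{\mathbb{Z}}\mathbb{Z}_{(p)}$ (viewed inside $K$). Newton polygon. Let $\phi\in\mathbb{Z}[x]$ be monic of degree $m$, irreducible modulo $p$, and let $f(x)=a_0(x)+a_1(x)\phi(x)+\cdots+a_r(x)\phi(x)^r$ with $a_i\in\mathbb{Z}[x]$, $\deg a_i<m$, be the $\phi$-adic development of $f$. Put $u_i=v_p(a_i(x))\in\mathbb{Z}\cup\{\infty\}$. The $\phi$-Newton polygon $N_\phi(f)$ is the lower convex envelope of the points $(i,u_i)$ with $u_i<\infty$; the principal polygon $N_\phi^-(f)$ is the part formed by its sides of negative slope. For $\phi=\phi_i$, $N_{\phi_i}^-(f)$ goes from abscissa $0$ to abscissa $\ell_i$, where its ordinate is $0$. (In the degenerate case $f=\phi_1$, one has $t=\ell_1=1$ and the polygon is the single point $(1,0)$, so $y_{1,1}=0$.) Residual polynomials. Put $\mathbb{F}_\phi=\mathbb{F}_p[x]/(\overline{\phi})$ and let $\mathrm{red}:\mathbb{Z}_p[x]\to\mathbb{F}_\phi$ be reduction modulo $(p,\phi(x))$. For an integer abscissa $i$ of $N_\phi^-(f)$ let $c_i=\mathrm{red}(a_i(x)/p^{u_i})$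 if $(i,u_i)$ lies on $N_\phi^-(f)$, and $c_i=0$ otherwise. If $S$ is a side of $N_\phi^-(f)$ of slope $-h/e$ ($h,e$ positive coprime integers), with initial abscissa $s$ and with projection to the $x$-axis of length $de$, the residual polynomial attached to $S$ is $c_s+c_{s+e}y+\cdots+c_{s+de}y^d\in\mathbb{F}_\phi[y]$. $f$ is $\phi$-regular if the residual polynomial of every side of $N_\phi^-(f)$ is separable (no multiple roots in an algebraic closure). $f$ is $p$-regular (with respect to $\phi_1,\dots,\phi_t$) if it is $\phi_i$-regular for every $1\le i\le t$. *)

(* Defs.v *)
From HB Require Import structures.
From mathcomp Require Import all_boot all_order all_algebra all_field.
From mathcomp Require Import ring lra.

Set Implicit Arguments.
Unset Strict Implicit.
Unset Printing Implicit Defensive.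

Import Order.TTheory GRing.Theory Num.Theory.
Import Pdiv.CommonRing Pdiv.RingMonic.

Local Open Scope ring_scope.

Definition seqmin {d : Order.disp_t} {T : orderType d} (x0 : T) (s : seq T) : T :=
  \big[Order.min/head x0 s]_(x <- s) x.

Lemma seqmin_le {d : Order.disp_t} {T : orderType d} (x0 x : T) (s : seq T) :
  x \in s -> (seqmin x0 s <= x)%O.
Proof.
rewrite /seqmin; elim: s (head x0 s) => //= a s IHs y.
rewrite inE big_cons ge_min => /orP[/eqP->|/IHs->]; rewrite ?lexx ?orbT //.
Qed.

Lemma seqmin_mem {d : Order.disp_t} {T : orderType d} (x0 : T) (s : seq T) :
  s != [::] -> seqmin x0 s \in s.
Proof.
have gen r (y : T) : \big[Order.min/y]_(x <- r) x \in y :: r.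
  elim: r => [|b r IHr]; first by rewrite big_nil mem_head.
  rewrite big_cons minElt !inE; case: ifP => _; first by rewrite eqxx orbT.
  by move: IHr; rewrite inE => /orP[->|->]; rewrite ?orbT.
case: s => // a s _; rewrite /seqmin /=.
by move: (gen (a :: s) a); rewrite !inE orbA orbb.
Qed.

(* The p-adic valuation of a nonzero integer polynomial. Its value at 0 (which
   is 0 here instead of +oo) is never used: zero coefficients of a phi-adic
   development are discarded by dev_supp below. *)
Definition vp (p : nat) (a : {poly int}) : nat :=
  seqmin 0%N [seq logn p `|c|%N | c <- a & c != 0].

Definition redp (p : nat) (a : {poly int}) : {poly 'F_p} := map_poly intr a.

(* The coefficient a_i(x) of the phi-adic development of f, for phi monic of
   positive degree; it vanishes for i >= size f. *)
Definition dev (phi f : {poly int}) (i : nat) : {poly int} :=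
  rmodp (rdivp f (phi ^+ i)) phi.

Lemma size_dev (phi f : {poly int}) (i : nat) :
  phi \is monic -> (size (dev phi f i) < size phi)%N.
Proof. by move=> mphi; rewrite ltn_rmodp monic_neq0. Qed.

Lemma dev_expansion (phi f : {poly int}) :
  phi \is monic -> (1 < size phi)%N ->
  f = \sum_(i < size f) dev phi f i * phi ^+ i.
Proof.
move=> mphi phi_gt1.
have mX n : phi ^+ n \is monic by apply: monic_exp.
have sX n : size (phi ^+ n) = ((size phi).-1 * n).+1.
  by rewrite -[LHS]prednK ?size_poly_gt0 ?monic_neq0 // size_exp.
have divS n : rdivp f (phi ^+ n.+1) = rdivp (rdivp f (phi ^+ n)) phi.
  set Q := rdivp f (phi ^+ n).
  suff -> : f = rdivp Q phi * phi ^+ n.+1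
                + (rmodp Q phi * phi ^+ n + rmodp f (phi ^+ n)).
    rewrite rdivp_addl_mul_small // sX (leq_ltn_trans (size_polyD _ _)) //.
    rewrite gtn_max; apply/andP; split; last first.
      apply: (@leq_trans (size (phi ^+ n))); first by rewrite ltn_rmodp monic_neq0.
      by rewrite sX ltnS leq_mul.
    have [->|nz] := eqVneq (rmodp Q phi) 0; first by rewrite mul0r size_poly0.
    rewrite size_Mmonic // sX addnS /= ltnS mulnS leq_add2r -ltnS prednK ?(ltnW phi_gt1) //.
    by rewrite ltn_rmodp monic_neq0.
  rewrite addrA exprS mulrA -mulrDl -rdivp_eq // /Q -rdivp_eq //.
have expand n : f = \sum_(i < n) dev phi f i * phi ^+ i
                    + rdivp f (phi ^+ n) * phi ^+ n.
  elim: n => [|n IHn]; first by rewrite big_ord0 add0r expr0 mulr1 {1}(rdivp_eq (monic1 _) f) mulr1 rmodp1 addr0.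
  rewrite {1}IHn big_ord_recr /= -addrA; congr (_ + _).
  by rewrite divS exprS mulrA -mulrDl addrC -rdivp_eq.
rewrite {1}(expand (size f)) rdivp_small ?mul0r ?addr0 // sX ltnS.
by rewrite leq_pmull // -subn1 subn_gt0.
Qed.

(* The abscissas i such that u_i is finite. *)
Definition dev_supp (phi f : {poly int}) : seq nat :=
  [seq i <- iota 0 (size f) | dev phi f i != 0].

Section NewtonPolygon.

Variables (p : nat) (phi f : {poly int}).

Local Notation u i := (vp p (dev phi f i)).

(* Ordinate at abscissa j of the segment from (a, u_a) to (b, u_b). For a = b
   the quotient is 0 and the value is u_a, as it should be. *)
Definition chord (a b j : nat) : rat :=
  (u a)%:R + ((u b)%:R - (u a)%:R) / (b%:R - a%:R) * (j%:R - a%:R).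

(* Ordinate at abscissa j of N_phi(f), the lower boundary of the convex hull of
   the points (i, u_i): the least ordinate at j of the segments joining two of
   these points (see np_ord_attained and np_ord_hull). Where the principal
   polygon is defined, it coincides with N_phi(f). *)
Definition np_ord (j : nat) : rat :=
  seqmin 0 [seq chord x.1 x.2 j |
             x <- [seq (a, b) | a <- dev_supp phi f, b <- dev_supp phi f]
             & (x.1 <= j <= x.2)%N].

Lemma np_ord_attained (j a b : nat) :
  a \in dev_supp phi f -> b \in dev_supp phi f -> (a <= j <= b)%N ->
  exists a' b' : nat,
    [/\ a' \in dev_supp phi f, b' \in dev_supp phi f, (a' <= j <= b')%N
      & np_ord j = chord a' b' j].
Proof.
move=> Ha Hb Hj; rewrite /np_ord; set l := map _ _.
have /mapP[[a' b']] : seqmin 0 l \in l.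
  apply: seqmin_mem; apply/eqP => l0.
  have : chord a b j \in l.
    by apply/mapP; exists (a, b); rewrite // mem_filter Hj; apply/allpairsP; exists (a, b).
  by rewrite l0.
rewrite mem_filter /= => /andP[Hj' /allpairsP[[x y] /= [Hx Hy]]].
by case=> ea eb ->; exists a', b'; split=> //; rewrite ?ea ?eb.
Qed.

Lemma np_ord_le (a b j : nat) :
  a \in dev_supp phi f -> b \in dev_supp phi f -> (a <= j <= b)%N ->
  np_ord j <= chord a b j.
Proof.
move=> Ha Hb Hj; apply: seqmin_le; apply/mapP; exists (a, b) => //.
by rewrite mem_filter Hj; apply/allpairsP; exists (a, b).
Qed.

Lemma np_ord_hull (j : nat) (w : nat -> rat) :
  (forall i, 0 <= w i) ->
  \sum_(i <- dev_supp phi f) w i = 1 ->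
  \sum_(i <- dev_supp phi f) w i * i%:R = j%:R ->
  np_ord j <= \sum_(i <- dev_supp phi f) w i * (u i)%:R.
Proof.
move=> w_ge0 w_sum w_bary; set S := dev_supp phi f in w_sum w_bary *.
pose v i : rat := (u i)%:R - np_ord j.
have v_j : j \in S -> 0 <= v j.
  move=> Sj; have := @np_ord_le j j j Sj Sj; rewrite leqnn => /(_ isT).
  by rewrite /chord !subrr mulr0 addr0 subr_ge0.
have v_pair a b : a \in S -> b \in S -> (a < j)%N -> (j < b)%N ->
    0 <= (b%:R - j%:R) * v a + (j%:R - a%:R) * v b.
  move=> Sa Sb aj jb; have := @np_ord_le a b j Sa Sb.
  rewrite (ltnW aj) (ltnW jb) => /(_ isT); rewrite /chord /v.
  have ajR : (a%:R : rat) < j%:R by rewrite ltr_nat.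
  have jbR : (j%:R : rat) < b%:R by rewrite ltr_nat.
  have ba_gt0 : (0 : rat) < b%:R - a%:R by lra.
  rewrite -subr_ge0 -(pmulr_rge0 _ ba_gt0).
  have ba_neq0 := lt0r_neq0 ba_gt0.
  by move=> H; apply: le_trans H _; rewrite le_eqVlt; apply/orP; left; apply/eqP; field.
rewrite -subr_ge0.
have -> : \sum_(i <- S) w i * (u i)%:R - np_ord j = \sum_(i <- S) w i * v i.
  have -> : np_ord j = \sum_(i <- S) w i * np_ord j.
    by rewrite -mulr_suml w_sum mul1r.
  rewrite -sumrB.
  by apply: eq_bigr => i _; rewrite /v mulrBr.
have split3 (F : nat -> rat) : \sum_(i <- S) F i =
    \sum_(i <- S | (i < j)%N) F i + \sum_(i <- S | (j < i)%N) F i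
    + \sum_(i <- S | i == j) F i.
  rewrite (bigID (fun i => i < j)%N) /= -addrA; congr (_ + _).
  rewrite (bigID (fun i => j < i)%N) /=; congr (_ + _); apply: eq_bigl => i.
    by case: ltngtP.
  by case: ltngtP.
pose D := \sum_(i <- S | (i < j)%N) w i * (j%:R - i%:R).
have D_right : D = \sum_(i <- S | (j < i)%N) w i * (i%:R - j%:R).
  have : \sum_(i <- S) w i * (i%:R - j%:R) = 0.
    under eq_bigr do rewrite mulrBr.
    by rewrite sumrB w_bary -mulr_suml w_sum mul1r subrr.
  rewrite split3 [X in _ + X]big1 => [|i /eqP->]; last by rewrite subrr mulr0.
  rewrite addr0 => /eqP; rewrite addrC addr_eq0 => /eqP->.
  by rewrite -sumrN; apply: eq_bigr => i _; rewrite -mulrN opprB.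
have mid_ge0 : 0 <= \sum_(i <- S | i == j) w i * v i.
  rewrite big_seq_cond; apply: sumr_ge0 => i /andP[Si /eqP ij].
  by rewrite mulr_ge0 // ij v_j // -ij.
have left_ge0 i : (i < j)%N -> 0 <= w i * (j%:R - i%:R).
  by move=> ij; rewrite mulr_ge0 // subr_ge0 ler_nat ltnW.
have right_ge0 i : (j < i)%N -> 0 <= w i * (i%:R - j%:R).
  by move=> ij; rewrite mulr_ge0 // subr_ge0 ler_nat ltnW.
have D_ge0 : 0 <= D by apply: sumr_ge0.
rewrite split3; apply: addr_ge0 => //.
have [D0|D_neq0] := eqVneq D 0.
  have /allP wl : all (fun i => (i < j)%N ==> (w i * (j%:R - i%:R) == 0)) S.
    by rewrite -psumr_eq0 // -/D D0.
  have /allP wr : all (fun i => (j < i)%N ==> (w i * (i%:R - j%:R) == 0)) S.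
    by rewrite -psumr_eq0 // -D_right D0.
  rewrite [X in X + _]big_seq_cond [X in _ + X]big_seq_cond !big1 ?addr0 // => i /andP[Si ij].
    move/implyP/(_ ij): (wr i Si); rewrite mulf_eq0 subr_eq0 eqr_nat gtn_eqF //.
    by rewrite orbF => /eqP->; rewrite mul0r.
  move/implyP/(_ ij): (wl i Si); rewrite mulf_eq0 subr_eq0 eqr_nat gtn_eqF //.
  by rewrite orbF => /eqP->; rewrite mul0r.
rewrite -(pmulr_rge0 _ (_ : 0 < D)); last by rewrite lt0r D_neq0.
rewrite mulrDr {1}D_right /D !mulr_suml.
under eq_bigr do rewrite mulr_sumr.
under [X in _ + X]eq_bigr do rewrite mulr_sumr.
rewrite exchange_big -big_split /= big_seq_cond.
apply: sumr_ge0 => a /andP[Sa aj].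
rewrite -big_split /= big_seq_cond; apply: sumr_ge0 => b /andP[Sb jb].
have := mulr_ge0 (mulr_ge0 (w_ge0 a) (w_ge0 b)) (v_pair a b Sa Sb aj jb).
by move=> H; apply: le_trans H _; rewrite le_eqVlt; apply/orP; left; apply/eqP; ring.
Qed.

(* N_phi(f) has a side of slope - h / e whose end points have abscissas s and
   s + d * e: the line of slope - h / e through these two points supports the
   polygon, and meets it only between them. *)
Definition np_side (h e s d : nat) : Prop :=
  [/\ [/\ (0 < h)%N, (0 < e)%N, coprime h e & (0 < d)%N],
      s \in dev_supp phi f, (s + d * e)%N \in dev_supp phi f,
      (e * u (s + d * e) + h * (s + d * e) = e * u s + h * s)%N
    & forall i, i \in dev_supp phi f ->
        (e * u s + h * s <= e * u i + h * i)%N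
        /\ ((e * u i + h * i = e * u s + h * s)%N -> (s <= i <= s + d * e)%N)].

(* F_phi = F_p[x] / (phi mod p) is {poly %/ redp p phi with phi_irr}. *)
Variable phi_irr : monic_irreducible_poly (redp p phi).

Definition red (a : {poly int}) : {poly %/ redp p phi with phi_irr} :=
  in_qpoly (redp p phi) (redp p a).

(* The division of the coefficients of a_i(x) by p ^ u_i is exact. *)
Definition res_coef (i : nat) : {poly %/ redp p phi with phi_irr} :=
  if (i \in dev_supp phi f) && ((u i)%:R == np_ord i)
  then red (map_poly (fun c : int => (c %/ (p ^ u i)%:Z)%Z) (dev phi f i))
  else 0.

Definition res_poly (e s d : nat) : {poly {poly %/ redp p phi with phi_irr}} :=
  \poly_(k < d.+1) res_coef (s + k * e).

Definition phi_regular : Prop :=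
  forall h e s d : nat, np_side h e s d -> separable_poly (res_poly e s d).

End NewtonPolygon.

Definition p_regular (p : nat) (f : {poly int}) (t : nat)
    (phi : 'I_t -> {poly int})
    (phi_irr : forall i, monic_irreducible_poly (redp p (phi i))) : Prop :=
  forall i, phi_regular f (phi_irr i).

Section Integrality.

Variables (p : nat) (K : fieldExtType rat).

(* The localization of Z at p, as a subring of Q. *)
Definition Zloc : pred rat := [pred x | ~~ (p %| `|denq x|)%N].

(* The localization of the ring of integers of K at Z \ pZ, i.e., the image of
   its tensor product with Zloc in K. *)
Definition OKloc (x : K) : Prop :=
  exists (z : K) (n : nat),
    [/\ integralOver (intr : int -> K) z, ~~ (p %| n)%N & x = z / n%:R].

Definition p_integral_basis (I : finType) (b : I -> K) : Prop :=
  [/\ forall i, OKloc (b i),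
      forall x, OKloc x -> exists2 c : I -> rat,
        forall i, c i \in Zloc & x = \sum_i c i *: b i
    & forall c : I -> rat, (forall i, c i \in Zloc) ->
        \sum_i c i *: b i = 0 -> forall i, c i = 0].

(* alpha_(i,j,k) / p ^ floor(y_(i,j)) for phi = phi_i. *)
Definition basis_elt (f phi : {poly int}) (theta : K) (j k : nat) : K :=
  (map_poly intr (rdivp f (phi ^+ j))).[theta] * theta ^+ k
    / p%:R ^ Num.floor (np_ord p phi f j).

End Integrality.

(* Main.v *)
Require Import Defs.
From HB Require Import structures.
From mathcomp Require Import all_boot all_order all_algebra all_field.
From mathcomp Require Import ring lra zify.

(** Write q_j for the quotient of f by phi^j, a_j for the coefficients of the
phi-adic development, y_j for the ordinates of the principal polygon, all at
a fixed phi unless an index i is shown.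

The family is a basis once it is saturated, that is, once p divides all the
coefficients of every integer combination which is p times a p-integral element.
Indeed a relation could then be divided by p for ever, so the family is free; it
has deg f elements, so it spans K; and the powers of p can be removed one at a
time from the denominators of the coordinates of a p-integral element
([p_integral_basis_of_saturated]).

Integrality rests on the identity
  q_i q_j = q_(i-1) q_(j+1) + a_j q_i - a_(i-1) q_(j+1)   at theta,
which follows from q_(j-1) = phi q_j + a_(j-1).  Since the polygon is convex, it
shows that the Z[theta]-module spanned by the q_j(theta) / p^floor(y_j) is closed
under multiplication; a characteristic polynomial does the rest
([quot_elt_integral]).

For saturation, multiply a combination by the product of the phi_i^ell_i for all
i but one.  At theta the product q_(i,j) phi_i^j is minus the remainder of f by
phi_i^j, and p^(floor(y_(i,j)) + 1) divides this remainder because the polygon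
decreases strictly ([other_term_int]).  So the other factors drop out, and what
remains is a sum of terms c_j q_j(theta) / p^(floor(y_j) + 1) for a single phi.
Suppose that some c_j is nonzero modulo (p, phi).  Among the corresponding j
take those with the least fractional part of y_j, then the largest of them, and
consider the side of slope - h / e above it, with first abscissa s and residual
polynomial R.  Let w be the valuation of Q[x] with w(p) = e and w(phi) = h whose
graded ring is, once the class of p is inverted and powers of it are neglected,
the polynomial ring over F_phi in the class X of phi.  The initial form of f is X^s R(X^e) ([side_poly_f]), and that of the
numerator G of the combination is a power of X times B(X^e), where B is a nonzero
combination of the truncations of R; in particular deg B < deg R
([sum_initial_summand]).  If the combination is p-integral, then the denominators
of its powers are bounded, so that a large power of G agrees modulo f with a
polynomial of larger value, and the initial form of f divides a power of that of
G ([integral_initial_form]).  As R is separable and R(0) is nonzero, R divides B,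
which is absurd by degree ([ndvd_exp_initial]).

The valuation w is realised by mapping x to xi + pi^h delta u, where pi^e = p,
the element xi is a root of phi, and delta inverts phi'(xi) modulo pi; reduction
modulo pi then computes initial forms ([ramified_model_exists]). *)

Set Implicit Arguments.
Unset Strict Implicit.
Unset Printing Implicit Defensive.

Import Order.TTheory GRing.Theory Num.Theory.
Import Pdiv.CommonRing Pdiv.RingMonic.

Local Open Scope ring_scope.

(** * Adjoining a root of a regular element *)

Section QuotientLift.

Variables (A T : comNzRingType) (h : {poly A}) (g : {rmorphism {poly A} -> T}).

(** The proof is an argument so that the morphism structure of the induced map can be
canonical. *)
Definition qpoly_lift of g (mk_monic h) = 0 := fun a : {poly %/ h} => g (a : {poly A}).

Hypothesis gh : g (mk_monic h) = 0.

Lemma lift_rmodp q : g (rmodp q (mk_monic h)) = g q.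
Proof.
by rewrite [in RHS](rdivp_eq (monic_mk_monic h) q) rmorphD rmorphM /= gh mulr0 add0r.
Qed.

Lemma qpoly_lift_in q : qpoly_lift gh (in_qpoly h q) = g q.
Proof. exact: lift_rmodp. Qed.

Fact qpoly_lift_zmod : zmod_morphism (qpoly_lift gh).
Proof. by move=> a b; rewrite /qpoly_lift /= !raddfB. Qed.

Fact qpoly_lift_monoid : monoid_morphism (qpoly_lift gh).
Proof.
split; first by rewrite /qpoly_lift /= rmorph1.
by move=> a b; rewrite /qpoly_lift /= lift_rmodp rmorphM.
Qed.

HB.instance Definition _ :=
  GRing.isZmodMorphism.Build {poly %/ h} T (qpoly_lift gh) qpoly_lift_zmod.
HB.instance Definition _ :=
  GRing.isMonoidMorphism.Build {poly %/ h} T (qpoly_lift gh) qpoly_lift_monoid.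

End QuotientLift.

Lemma in_qpolyK (A : nzRingType) (h : {poly A}) (a : {poly %/ h}) :
  in_qpoly h a = a.
Proof. by apply/val_inj/rmodp_small/size_mk_monic. Qed.

(** The extension is A[X] / (X^e - a0), with pi the class of X.  An element which
reduces to 0 has its constant term in a0 A = pi^e A, hence is a multiple of pi;
and X a = q (X^e - a0) forces q(0) a0 = 0, so that X divides q and a = 0. *)
Lemma root_adjunction (A F : comNzRingType) (a0 : A) (rho : {rmorphism A -> F}) e :
    (0 < e)%N -> (forall a, a0 * a = 0 -> a = 0) ->
    (forall a, rho a = 0 <-> exists b, a = a0 * b) ->
  exists (S : comNzRingType) (iota : {rmorphism A -> S}) (pi : S)
    (rhoS : {rmorphism S -> F}),
    [/\ pi ^+ e = iota a0, forall a, rhoS (iota a) = rho a,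
        forall a, pi * a = 0 -> a = 0
      & forall a, rhoS a = 0 <-> exists b, a = pi * b].
Proof.
move=> e_gt0 regA kerA.
pose h : {poly A} := 'X^e - a0%:P.
have hm : h \is monic by apply: monicXnsubC.
have sh : size h = e.+1 by rewrite size_XnsubC.
have hE : mk_monic h = h by rewrite /mk_monic sh hm ltnS e_gt0.
pose g : {rmorphism {poly A} -> F} := rho \o horner_eval 0.
have gE q : g q = rho q.[0] by [].
have gh : g (mk_monic h) = 0.
  rewrite hE gE !hornerE expr0n gtn_eqF // sub0r rmorphN; apply/eqP.
  by rewrite oppr_eq0; apply/eqP/kerA; exists 1; rewrite mulr1.
pose S : comNzRingType := {poly %/ h}.
pose pi : S := in_qpoly h 'X.
exists S, (qpolyC h : {rmorphism A -> S}), pi, (qpoly_lift gh : {rmorphism S -> F}).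
have piXe : pi ^+ e = qpolyC h a0.
  have -> : qpolyC h a0 = in_qpoly h a0%:P by rewrite -[LHS]in_qpolyK.
  rewrite -rmorphXn; apply/eqP; rewrite -subr_eq0 -raddfB -/h.
  by apply/eqP/val_inj; rewrite /= hE rmodpp.
have XdivA (q : {poly A}) : exists q', q = q.[0]%:P + 'X * q'.
  elim/poly_ind: q => [|q c _]; first by exists 0; rewrite horner0 mulr0 addr0.
  by exists q; rewrite !hornerE addrC mulrC.
have Xreg (a : {poly A}) : (size a < size h)%N -> rmodp ('X * a) (mk_monic h) = 0 -> a = 0.
  rewrite hE => sa Ea; have := rdivp_eq hm ('X * a); rewrite Ea addr0.
  move: (rdivp _ _) => q Eq.
  have q0 : q.[0] = 0.
    apply: regA; move: (congr1 (horner^~ 0) Eq); rewrite !hornerE.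
    rewrite expr0n gtn_eqF // sub0r mulrN => E0.
    by rewrite mulrC -[LHS]opprK -E0 oppr0.
  have [q' Eq'] := XdivA q; move: Eq; rewrite Eq' q0 add0r -mulrA => EX.
  have Eaq : a = q' * h.
    by apply/polyP => i; move/polyP/(_ i.+1): EX; rewrite !coefXM.
  by rewrite -(rmodp_small sa) Eaq rmodp_mull.
split=> //.
- by move=> a; rewrite /= /qpoly_lift /= /horner_eval hornerC.
- move=> a /(congr1 val) /=; rewrite rmodp_mulml ?monic_mk_monic // => Ea.
  apply/val_inj/Xreg => //=.
  by apply: leq_trans (size_mk_monic a) _; rewrite hE.
- move=> a; split.
    rewrite /= /qpoly_lift /= => /kerA[b Eb]; have [a' Ea'] := XdivA a.
    exists (pi ^+ e.-1 * qpolyC h b + in_qpoly h a').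
    have -> : a = in_qpoly h a.[0]%:P + in_qpoly h ('X * a').
      by rewrite -[LHS]in_qpolyK {1}Ea' in_qpolyD.
    rewrite mulrDr mulrA -exprS prednK // piXe [in LHS]in_qpolyM -/pi; congr (_ + _).
    rewrite /horner_eval in Eb; rewrite Eb -[LHS]/(in_qpoly h _) -[RHS]qpolyCM.
    by rewrite -[RHS]in_qpolyK.
  case=> b ->; pose lf : {rmorphism S -> F} := qpoly_lift gh.
  have lf_pi : lf pi = 0 by apply: etrans (qpoly_lift_in gh _) _; rewrite gE hornerX rmorph0.
  by rewrite -[LHS]/(lf (pi * b)) rmorphM lf_pi mul0r.
Qed.

(** * Reduction modulo p and phi *)

Section Reduction.

Variables (p : nat) (phi : {poly int}).
Hypothesis p_prime : prime p.
Hypothesis phi_monic : phi \is monic.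
Hypothesis phi_irr : monic_irreducible_poly (redp p phi).

Local Notation F := {poly %/ redp p phi with phi_irr}.

Lemma intr_Fp_eq0 (c : int) : ((c%:~R : 'F_p) == 0) = (p %| c)%Z.
Proof. by rewrite (dvdz_pcharf (pchar_Fp p_prime)). Qed.

Lemma redp_is_zmod : zmod_morphism (redp p).
Proof. by move=> a b; rewrite /redp raddfB. Qed.
Lemma redp_is_monoid : monoid_morphism (redp p).
Proof. by split=> [|a b]; rewrite /redp (rmorph1, rmorphM). Qed.
HB.instance Definition _ := GRing.isZmodMorphism.Build _ _ (redp p) redp_is_zmod.
HB.instance Definition _ := GRing.isMonoidMorphism.Build _ _ (redp p) redp_is_monoid.

Lemma redp_eq0 (a : {poly int}) : redp p a = 0 <-> exists b, a = p%:R * b.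
Proof.
split=> [a0|[b ->]]; last first.
  rewrite rmorphM rmorph_nat -polyC_natr.
  by rewrite (pcharf0 (pchar_Fp p_prime)) mul0r.
exists (map_poly (fun c => (c %/ p)%Z) a); apply/polyP => i.
rewrite -polyC_natr coefCM coef_map_id0 ?div0z // mulrC.
rewrite natz divzK // -intr_Fp_eq0.
by move/polyP/(_ i): a0; rewrite coef_map coef0 /= => ->.
Qed.

Lemma redp_surj (q : {poly 'F_p}) : exists a, redp p a = q.
Proof.
exists (map_poly (fun c : 'F_p => Posz (c : nat)) q); apply/polyP => i.
by rewrite coef_map coef_map_id0 //= -pmulrn natr_Zp.
Qed.

Lemma size_redp_monic (a : {poly int}) : a \is monic -> size (redp p a) = size a.
Proof.
by move=> /monicP a1; rewrite size_map_poly_id0 // a1 oner_eq0.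
Qed.

Lemma size_phi_gt1 : (1 < size phi)%N.
Proof. by rewrite -size_redp_monic //; case: phi_irr.1. Qed.

Lemma mk_monic_phi : mk_monic phi = phi.
Proof. by rewrite /mk_monic size_phi_gt1 phi_monic. Qed.

Lemma red_is_zmod : zmod_morphism (red phi_irr).
Proof. by move=> a b; rewrite /red !raddfB. Qed.
Lemma red_is_monoid : monoid_morphism (red phi_irr).
Proof. by split=> [|a b]; rewrite /red (rmorph1, rmorphM) ?(in_qpoly1, in_qpolyM). Qed.
HB.instance Definition _ := GRing.isZmodMorphism.Build _ _ (red phi_irr) red_is_zmod.
HB.instance Definition _ := GRing.isMonoidMorphism.Build _ _ (red phi_irr) red_is_monoid.

Lemma in_qfpoly_eq0 (q : {poly 'F_p}) :
  (in_qpoly (redp p phi) q == 0) = (redp p phi %| q).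
Proof.
rewrite -val_eqE /= mk_monicE ?phi_irr // -Pdiv.IdomainMonic.modpE ?phi_irr //.
Qed.

Lemma red_eq0 a : red phi_irr a = 0 <-> exists b c, a = phi * b + p%:R * c.
Proof.
split=> [/eqP|[b [c ->]]].
  rewrite in_qfpoly_eq0 => /dvdpP[q Eq].
  have [b Eb] := redp_surj q.
  have [|c Ec] := (redp_eq0 (a - phi * b)).1.
    by rewrite rmorphB rmorphM /= Eq Eb mulrC subrr.
  by exists b, c; rewrite -Ec addrC subrK.
apply/eqP; rewrite in_qfpoly_eq0 rmorphD !rmorphM /= dvdp_add ?dvdp_mulIl //.
have -> : redp p p%:R = 0 by apply/redp_eq0; exists 1; rewrite mulr1.
by rewrite mul0r dvdp0.
Qed.

Lemma red_surj (x : F) : exists a, red phi_irr a = x.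
Proof.
have [a Ea] := redp_surj (x : {poly 'F_p}); exists a.
by rewrite /red Ea; apply: in_qpolyK.
Qed.

Lemma red_phi : red phi_irr phi = 0.
Proof. by apply/red_eq0; exists 1, 0; rewrite mulr1 mulr0 addr0. Qed.

Lemma red_p : red phi_irr p%:R = 0.
Proof. by apply/red_eq0; exists 0, 1; rewrite mulr1 mulr0 add0r. Qed.

(** Modulo p, phi divides X^q - X with q the cardinal of F_phi, and the derivative of
X^q - X is -1. *)
Lemma red_deriv_neq0 : red phi_irr phi^`() != 0.
Proof.
apply/eqP => d0.
pose q := (#|F|)%N.
have : redp p phi %| 'X^q - 'X.
  rewrite -in_qfpoly_eq0; apply/eqP.
  transitivity ((in_qpoly (redp p phi) 'X : F) ^+ q - in_qpoly (redp p phi) 'X).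
    by rewrite raddfB /=; congr (_ - _); elim: (q) => [|k IH];
      rewrite ?in_qpoly1 // exprS in_qpolyM IH exprS.
  by rewrite expf_card subrr.
case/dvdpP => Q EQ.
have q0 : (q%:R : 'F_p) = 0.
  rewrite /q card_qfpoly card_Fp // natrX (pcharf0 (pchar_Fp p_prime)) expr0n.
  by rewrite size_redp_monic // -subn1 subn_eq0 leqNgt size_phi_gt1.
move/(congr1 (@deriv _)): EQ; rewrite derivB derivXn derivX derivM -mulr_natr.
rewrite -polyC_natr q0 mulr0 sub0r => E.
have : (-1 : F) = 0.
  transitivity (in_qpoly (redp p phi) (-1) : F); first by rewrite raddfN /= in_qpoly1.
  rewrite E in_qpolyD !in_qpolyM.
  have -> : in_qpoly (redp p phi) (redp p phi) = 0 by have := red_phi.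
  have -> : in_qpoly (redp p phi) (redp p phi)^`() = 0.
    by have := d0; rewrite /red /redp deriv_map.
  by rewrite !mulr0 addr0.
by move/eqP; rewrite oppr_eq0 oner_eq0.
Qed.

End Reduction.

(** * Initial forms for the valuation of a side *)

Lemma rmorph_poly_intE (T : nzRingType) (g : {rmorphism {poly int} -> T}) a :
  g a = (map_poly intr a).[g 'X].
Proof.
elim/poly_ind: a => [|a c IH]; first by rewrite !rmorph0 horner0.
rewrite rmorphD rmorphM /= IH [in RHS]rmorphD rmorphM /= map_polyX map_polyC /=.
rewrite hornerD hornerMX hornerC; congr (_ + _).
by rewrite -[RHS](rmorph_int (g \o polyC)) intz.
Qed.

Lemma taylor1 (T : comNzRingType) (P : {poly T}) x w :
  exists r, P.[x + w] = P.[x] + P^`().[x] * w + w ^+ 2 * r.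
Proof.
elim/poly_ind: P => [|P c [r IH]].
  by exists 0; rewrite deriv0 !horner0; ring.
exists (P^`().[x] + r * (x + w)).
by rewrite derivD derivM derivX derivC !hornerE IH; ring.
Qed.

Section Model.

Variables (p : nat) (phi : {poly int}).
Hypothesis p_prime : prime p.
Hypothesis phi_monic : phi \is monic.
Hypothesis phi_irr : monic_irreducible_poly (redp p phi).

Local Notation F := {poly %/ redp p phi with phi_irr}.
Local Notation red := (red phi_irr).

(** The ring S plays the part of the valuation ring of the valuation with value e at
p and h at phi: sigma is the inclusion of Z[x], pi a uniformizer, and rho the
reduction modulo pi, normalised so that the class of phi is the variable. *)
Record ramified_model (e h : nat) (S : comNzRingType)
    (sigma : {rmorphism {poly int} -> S}) (pi : S)
    (rho : {rmorphism S -> {poly F}}) : Prop := RamifiedModel {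
  pi_reg : forall a, pi * a = 0 -> a = 0;
  ker_rho : forall a, rho a = 0 <-> exists b, a = pi * b;
  sigma_p : sigma p%:R = pi ^+ e;
  rho_sigma : forall a, rho (sigma a) = (red a)%:P;
  sigma_phi : exists2 eps, sigma phi = pi ^+ h * eps & rho eps = 'X }.

(** Take O = Z[x] / (phi), in which p is a prime element with residue field F_phi,
then O[u], and adjoin an e-th root pi of p.  Under x |-> xi + pi^h delta u, with
xi the class of x, Taylor's formula gives phi |-> pi^h (phi'(xi) delta u + ...),
where the omitted terms are multiples of pi because h is positive. *)
Lemma ramified_model_exists e h : (0 < e)%N -> (0 < h)%N ->
  exists S sigma pi rho, @ramified_model e h S sigma pi rho.
Proof.
move=> e_gt0 h_gt0.
pose O : comNzRingType := {poly %/ phi}.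
pose red' : {rmorphism {poly int} -> F} := red.
have mkphi := mk_monic_phi phi_monic phi_irr.
have red_mk : red' (mk_monic phi) = 0 by rewrite mkphi; apply: red_phi.
pose rO : {rmorphism O -> F} := qpoly_lift red_mk.
have rOE a : rO (in_qpoly phi a) = red a by apply: (qpoly_lift_in red_mk).
have qO (x : O) : in_qpoly phi x = x by apply: in_qpolyK.
have pO a : in_qpoly phi (p%:R * a) = p%:R * in_qpoly phi a :> O.
  by rewrite in_qpolyM; congr (_ * _); apply: (rmorph_nat (in_qpoly phi)).
have phiO : in_qpoly phi phi = 0 by apply/val_inj; rewrite /= mkphi rmodpp.
have regO (x : O) : p%:R * x = 0 -> x = 0.
  rewrite mulr_natl => px; apply/val_inj/polyP => i.
  move/(congr1 val)/polyP/(_ i): px; rewrite [val _](raddfMn val) /= coefMn !coef0.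
  by move/eqP; rewrite mulrn_eq0 (gtn_eqF (prime_gt0 p_prime)) => /eqP.
have kerO (x : O) : rO x = 0 <-> exists y, x = p%:R * y.
  split=> [|[y ->]]; last by rewrite rmorphM rmorph_nat -(rmorph_nat red') [red' _]red_p // mul0r.
  rewrite -(qO x) rOE => /(red_eq0 p_prime)[b [c ->]].
  by exists (in_qpoly phi c); rewrite in_qpolyD in_qpolyM phiO mul0r add0r pO.
pose A : comNzRingType := {poly O}.
have regA (a : A) : p%:R * a = 0 -> a = 0.
  move=> pa; apply/polyP => i; rewrite coef0; apply: regO.
  by move/polyP/(_ i): pa; rewrite -polyC_natr coefCM coef0.
pose rA : {rmorphism A -> {poly F}} := map_poly rO.
have kerA (a : A) : rA a = 0 <-> exists b, a = p%:R * b.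
  split=> [a0|[b ->]]; last first.
    by rewrite rmorphM rmorph_nat -polyC_natr -(rmorph_nat red') [red' _]red_p // mul0r.
  have co i : {y : O | a`_i == p%:R * y}.
    apply: sigW; have [|y ->] := (kerO a`_i).1; last by exists y.
    by move/polyP/(_ i): a0; rewrite coef_map coef0.
  exists (\poly_(i < size a) sval (co i)); apply/polyP => i.
  rewrite -polyC_natr coefCM coef_poly; case: ltnP => si.
    by apply/eqP; case: (co i).
  by rewrite mulr0 nth_default.
have [S [iota [pi [rho [piE rhoE pireg rhoker]]]]] := root_adjunction e_gt0 regA kerA.
have [dl Edl] := red_surj ((red phi^`() : F)^-1).
pose w := pi ^+ h * iota ((in_qpoly phi dl : O)%:P * 'X).
pose xi : S := iota (in_qpoly phi 'X : O)%:P.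
pose sg : {rmorphism {poly int} -> S} := horner_eval (xi + w) \o map_poly intr.
have sgE a : sg a = (map_poly intr a).[xi + w] by [].
have xiE a : (map_poly intr a).[xi] = iota (in_qpoly phi a)%:P.
  pose g1 : {rmorphism {poly int} -> S} := iota \o (polyC \o in_qpoly phi).
  exact: esym (rmorph_poly_intE g1 a).
have rho_pi : rho pi = 0 by apply/rhoker; exists 1; rewrite mulr1.
have rho_in a : rho (iota (in_qpoly phi a)%:P) = (red a)%:P.
  by rewrite rhoE -(rOE a); apply: map_polyC.
have rho_w : rho w = 0 by rewrite rmorphM rmorphXn rho_pi expr0n gtn_eqF ?mul0r.
have rho_tay x y r : rho (x + y * w + w ^+ 2 * r) = rho x.
  have -> : x + y * w + w ^+ 2 * r = x + w * (y + w * r) by ring.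
  by rewrite raddfD /= [rho (w * _)](rmorphM rho) rho_w mul0r addr0.
exists S, sg, pi, rho; split=> //.
- by rewrite rmorph_nat piE rmorph_nat.
- move=> a; rewrite sgE; have [r ->] := taylor1 (map_poly intr a) xi w.
  by rewrite rho_tay xiE rho_in.
have [r Er] := taylor1 (map_poly intr phi) xi w.
exists (iota (in_qpoly phi phi^`())%:P * iota ((in_qpoly phi dl : O)%:P * 'X)
         + w * (iota ((in_qpoly phi dl : O)%:P * 'X) * r)).
  rewrite sgE Er xiE phiO rmorph0 add0r deriv_map xiE /w.
  by move: (iota _) (iota _) => a b; ring.
rewrite raddfD /= [rho (w * _)](rmorphM rho) rho_w mul0r addr0.
rewrite (rmorphM iota) !(rmorphM rho) !rho_in [rho (iota 'X)]rhoE.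
rewrite [rA 'X]map_polyX Edl mulrA -polyCM mulfV ?mul1r //.
exact: red_deriv_neq0.
Qed.

Section Initial.

Variables (e h : nat) (S : comNzRingType)
    (sigma : {rmorphism {poly int} -> S}) (pi : S)
    (rho : {rmorphism S -> {poly F}}).
Hypothesis M : ramified_model e h sigma pi rho.

(** The value of g is at least E, and P is its class in degree E of the graded ring;
in particular P = 0 exactly when the value exceeds E. *)
Definition initial (E : nat) (g : {poly int}) (P : {poly F}) : Prop :=
  exists2 g0, sigma g = pi ^+ E * g0 & rho g0 = P.

Lemma pi_exp_reg k a b : pi ^+ k * a = pi ^+ k * b -> a = b.
Proof.
move/eqP; rewrite -subr_eq0 -mulrBr => /eqP ab0; apply/eqP; rewrite -subr_eq0.
apply/eqP; elim: k ab0 => [|k IH]; first by rewrite mul1r.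
by rewrite exprS -mulrA => /(pi_reg M).
Qed.

Lemma initial_const a : initial 0 a (red a)%:P.
Proof. by exists (sigma a); rewrite ?mul1r ?(rho_sigma M). Qed.

Lemma initial_p : initial e p%:R 1.
Proof. by exists 1; rewrite ?mulr1 ?rmorph1 ?(sigma_p M). Qed.

Lemma initial_phi : initial h phi 'X.
Proof. by have [eps E1 E2] := sigma_phi M; exists eps. Qed.

Lemma initialM E1 E2 g1 g2 P1 P2 : initial E1 g1 P1 -> initial E2 g2 P2 ->
  initial (E1 + E2) (g1 * g2) (P1 * P2).
Proof.
move=> [a1 s1 r1] [a2 s2 r2]; exists (a1 * a2); rewrite rmorphM ?r1 ?r2 //=.
by rewrite s1 s2 exprD mulrACA.
Qed.

Lemma initialD E g1 g2 P1 P2 : initial E g1 P1 -> initial E g2 P2 ->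
  initial E (g1 + g2) (P1 + P2).
Proof.
move=> [a1 s1 r1] [a2 s2 r2]; exists (a1 + a2); rewrite rmorphD ?r1 ?r2 //=.
by rewrite s1 s2 mulrDr.
Qed.

Lemma initialN E g P : initial E g P -> initial E (- g) (- P).
Proof.
move=> [a s r]; exists (- a); last by rewrite -r; apply: raddfN.
by rewrite mulrN -s; apply: raddfN.
Qed.

Lemma initial0 E : initial E 0 0.
Proof. by exists 0; rewrite !rmorph0 ?mulr0. Qed.

Lemma initial_sum E (I : Type) (r : seq I) (Q : pred I) g P :
  (forall i, Q i -> initial E (g i) (P i)) ->
  initial E (\sum_(i <- r | Q i) g i) (\sum_(i <- r | Q i) P i).
Proof.
move=> H; elim/big_rec2: _ => [|i a b Qi]; first exact: initial0.
by move=> ab; apply: initialD => //; apply: H.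
Qed.

Lemma initialX E g P k : initial E g P -> initial (E * k) (g ^+ k) (P ^+ k).
Proof.
move=> H; elim: k => [|k IH]; last by rewrite mulnS !exprS; apply: initialM.
rewrite muln0 !expr0; have := initial_const 1; rewrite [X in X%:P](rmorph1 red).
by [].
Qed.

Lemma initial_lt E E' g P : (E' < E)%N -> initial E g P -> initial E' g 0.
Proof.
move=> lt_E [a s r]; exists (pi ^+ (E - E') * a).
  by rewrite s mulrA -exprD subnKC // ltnW.
rewrite rmorphM rmorphXn (_ : rho pi = 0); last first.
  by apply/(ker_rho M); exists 1; rewrite mulr1.
by rewrite expr0n subn_eq0 leqNgt lt_E mul0r.
Qed.

(** The reduction ring is a domain, so pi is prime: as pi does not divide the image
of f, all the powers of pi come from the cofactor k. *)
Lemma initial_divides E f P E' k Q : initial E f P -> P != 0 -> initial (E + E') (f * k) Q ->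
  exists K, Q = P * K.
Proof.
move=> [f0 sf rf] P0 [q sq rq].
suff [k0 sk] : exists k0, sigma k = pi ^+ E' * k0.
  exists (rho k0); rewrite -rf -rmorphM -rq; congr (rho _).
  by apply: (@pi_exp_reg (E + E')); rewrite -sq rmorphM sf sk exprD mulrACA.
have {sq} : f0 * sigma k = pi ^+ E' * q.
  apply: (@pi_exp_reg E); rewrite mulrA -sf -rmorphM sq mulrA exprD //.
elim: E' {rq} q (sigma k) => [|E' IH] q b; first by exists b; rewrite mul1r.
rewrite exprS -mulrA => Eb.
have : rho (f0 * b) = 0 by rewrite (ker_rho M); exists (pi ^+ E' * q).
rewrite rmorphM rf => /eqP; rewrite mulf_eq0 (negPf P0) => /eqP /(ker_rho M)[c Ec].
have [|k0 Ek0] := IH q c; last by exists k0; rewrite Ec Ek0 mulrA.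
apply: (@pi_exp_reg 1); rewrite expr1 -Eb Ec; ring.
Qed.

End Initial.

End Model.

(** * Powers of p-integral elements *)

Section Evaluation.

Variables (p : nat) (K : fieldExtType rat) (theta : K).
Hypothesis p_prime : prime p.

Definition eval_at (g : {poly int}) : K := (map_poly intr g).[theta].

Lemma ev_is_zmod : zmod_morphism eval_at.
Proof. by move=> a b; rewrite /eval_at rmorphB hornerD hornerN. Qed.
Lemma ev_is_monoid : monoid_morphism eval_at.
Proof. by split=> [|a b]; rewrite /eval_at (rmorph1, rmorphM) ?hornerC ?hornerM. Qed.
HB.instance Definition _ := GRing.isZmodMorphism.Build _ _ eval_at ev_is_zmod.
HB.instance Definition _ := GRing.isMonoidMorphism.Build _ _ eval_at ev_is_monoid.

Variable f : {poly int}.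
Hypothesis f_monic : f \is monic.
Hypothesis f_irr : irreducible_poly f.
Hypothesis theta_root : root (map_poly intr f) theta.

Lemma ev_f : eval_at f = 0. Proof. exact/rootP. Qed.

Lemma natK_eq0 n : ((n%:R : K) == 0) = (n == 0)%N.
Proof. by rewrite -(rmorph_nat (in_alg K)) fmorph_eq0 pnatr_eq0. Qed.

Lemma ev_rmodp g : eval_at (rmodp g f) = eval_at g.
Proof.
by rewrite [in RHS](rdivp_eq f_monic g) rmorphD rmorphM /= ev_f mulr0 add0r.
Qed.

(** By Gauss's lemma f stays irreducible over Q, hence is coprime to every nonzero
polynomial of smaller degree. *)
Lemma ev_eq0 g : eval_at g = 0 -> exists k, g = f * k.
Proof.
move=> g0; exists (rdivp g f); rewrite mulrC [LHS](rdivp_eq f_monic).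
suff -> : rmodp g f = 0 by rewrite addr0.
apply/eqP; apply: contraT => r0.
pose fQ := map_poly (intr : int -> rat) f; pose rQ := map_poly (intr : int -> rat) (rmodp g f).
have fQ_irr : irreducible_poly fQ by apply/irreducible_rat_int.
have sz (a : {poly int}) : size (map_poly (intr : int -> rat) a) = size a.
  by rewrite size_map_inj_poly //; apply: intr_inj.
have mapK (a : {poly int}) : map_poly (in_alg K) (map_poly (intr : int -> rat) a) = map_poly intr a.
  rewrite -map_poly_comp; apply: eq_map_poly => c /=.
  by rewrite -[LHS]/(in_alg K _) rmorph_int.
have cop : coprimep fQ rQ.
  rewrite irreducible_poly_coprime //; apply: contraL r0 => /dvdp_leq Hle.
  apply/negPn; rewrite -size_poly_eq0 -sz size_poly_eq0; apply: contraT => /Hle.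
  by rewrite !sz leqNgt ltn_rmodp monic_neq0.
rewrite -(coprimep_map (in_alg K)) !mapK in cop.
have := coprimep_root cop (x := theta); rewrite theta_root => /(_ isT).
by rewrite -[X in X != 0]/(eval_at _) ev_rmodp g0 eqxx.
Qed.

Local Notation OK := (@OKloc p K).

Lemma OKlocD x y : OK x -> OK y -> OK (x + y).
Proof.
move=> [z [n [iz pn ->]]] [w [m [iw pm ->]]].
exists (m%:R * z + n%:R * w), (n * m)%N; split.
- by apply: integral_add; apply: integral_mul => //; apply: integral_nat.
- by rewrite Euclid_dvdM // negb_or pn.
have n0 : (n%:R : K) != 0 by rewrite natK_eq0; case: (n) pn => //; rewrite dvdn0.
have m0 : (m%:R : K) != 0 by rewrite natK_eq0; case: (m) pm => //; rewrite dvdn0.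
by rewrite natrM; field; rewrite n0 m0.
Qed.

Lemma OKlocM x y : OK x -> OK y -> OK (x * y).
Proof.
move=> [z [n [iz pn ->]]] [w [m [iw pm ->]]].
exists (z * w), (n * m)%N; split; first exact: integral_mul.
  by rewrite Euclid_dvdM // negb_or pn.
by rewrite natrM invfM mulrACA.
Qed.

Lemma OKloc_int z : integralOver (intr : int -> K) z -> OK z.
Proof.
move=> iz; exists z, 1%N; split; rewrite ?divr1 // dvdn1.
by case: eqP p_prime => // ->.
Qed.

Lemma ev_int g : integralOver (intr : int -> K) (eval_at g).
Proof.
have it : integralOver (intr : int -> K) theta by exists f.
apply: integral_horner => //; apply/integral_poly => i.
by rewrite coef_map; apply: integral_id.
Qed.

Lemma OKloc_ev g : OK (eval_at g). Proof. exact/OKloc_int/ev_int. Qed.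

Lemma OKlocN x : OK x -> OK (- x).
Proof.
move=> Ox; rewrite -mulN1r; apply: OKlocM => //.
by have := OKloc_ev (-1); rewrite rmorphN1.
Qed.

Lemma OKloc_sum (I : Type) (r : seq I) (Q : pred I) F :
  (forall i, Q i -> OK (F i)) -> OK (\sum_(i <- r | Q i) F i).
Proof.
move=> H; apply: (big_ind (fun x => OK x)) => //.
  by have := OKloc_ev 0; rewrite rmorph0.
exact: OKlocD.
Qed.

(** If z = n x is a root of a monic integer polynomial of degree d, then all powers
of z are integer combinations of 1, z, ..., z^(d-1). *)
Lemma OKloc_bounded_powers c G x : p%:R ^+ c * x = eval_at G -> OK x ->
  exists n T, ~~ (p %| n)%N /\
    forall N, exists H, p%:R ^+ T * n%:R ^+ N * x ^+ N = eval_at H.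
Proof.
move=> xG [z [n [[q mq qz] pn xE]]].
have n0 : (n%:R : K) != 0 by rewrite natK_eq0; case: (n) pn => //; rewrite dvdn0.
have nx : n%:R * x = z by rewrite xE mulrC divfK.
exists n, (c * size q)%N; split=> // N.
rewrite -mulrA -exprMn nx.
have -> : z ^+ N = (map_poly intr (rmodp 'X^N q)).[z].
  have := congr1 (fun g : {poly int} => (map_poly intr g).[z]) (rdivp_eq mq 'X^N).
  rewrite rmorphXn /= map_polyX hornerXn => ->.
  by rewrite rmorphD rmorphM /= hornerD hornerM (rootP qz) mulr0 add0r.
set r := rmodp _ q.
have sr : (size r <= size q)%N by rewrite ltnW // ltn_rmodp monic_neq0.
pose t (i : 'I_(size r)) := (r`_i)%:P * p%:R ^+ (c * (size q - i)) * (n%:R * G) ^+ i.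
exists (\sum_(i < size r) t i).
rewrite rmorph_sum (@horner_coef_wide _ (size r)) ?size_poly // mulr_sumr.
apply: eq_bigr => i _; rewrite coef_map /= /t !rmorphM !rmorphXn /= !rmorph_nat.
have -> : eval_at (r`_i)%:P = (r`_i)%:~R by rewrite /eval_at map_polyC hornerC.
have -> : eval_at (n%:R * G) = p%:R ^+ c * z.
  by rewrite rmorphM rmorph_nat /= -xG -nx mulrCA.
have -> : (c * size q = c * (size q - i) + c * i)%N.
  by rewrite -mulnDr subnK // (leq_trans _ sr) // ltnW.
by rewrite exprMn -exprM exprD; ring.
Qed.

End Evaluation.

(** * Divisibility of initial forms *)

Section Core.

Variables (p : nat) (K : fieldExtType rat) (theta : K).
Hypothesis p_prime : prime p.
Variables (f phi : {poly int}).
Hypothesis f_monic : f \is monic.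
Hypothesis f_irr : irreducible_poly f.
Hypothesis theta_root : root (map_poly intr f) theta.
Hypothesis phi_irr : monic_irreducible_poly (redp p phi).

Local Notation F := {poly %/ redp p phi with phi_irr}.
Local Notation red := (red phi_irr).
Local Notation ev := (eval_at theta).

Lemma red_nat_neq0 n : ~~ (p %| n)%N -> red n%:R != 0.
Proof.
move=> pn; have -> : red n%:R = in_qpoly (redp p phi) (n%:R) :> F.
  by rewrite /red rmorph_nat.
have n0 : (n%:R : 'F_p) != 0 by rewrite -(dvdn_pcharf (pchar_Fp p_prime)).
rewrite (in_qfpoly_eq0 phi_irr); apply/negP => /dvdp_leq.
rewrite -polyC_natr polyC_eq0 => /(_ n0); rewrite size_polyC n0.
by rewrite leqNgt; case: phi_irr.1 => ->.
Qed.

Variables (e h : nat) (S : comNzRingType)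
    (sigma : {rmorphism {poly int} -> S}) (pi : S)
    (rho : {rmorphism S -> {poly F}}).
Hypothesis M : ramified_model e h sigma pi rho.
Local Notation initial := (initial sigma pi rho).

(** Raise to a large power N and clear denominators: up to a bounded power of p, the
element G^N is congruent modulo f to a multiple of p^((nu + 1) N) phi^(J N).  The
value of G^N is lower by (e - kap) N, so its initial form must come from the multiple of
f. *)
Lemma integral_initial_form x c G' nu J G kap P k0 Pf :
    OKloc p x -> p%:R ^+ c * x = ev G' ->
    p%:R ^+ nu.+1 * ev phi ^+ J * x = ev G ->
    initial (h * J + e * nu + kap) G P -> (kap < e)%N ->
    initial k0 f Pf -> Pf != 0 ->
  exists N, Pf %| P ^+ N.
Proof.
move=> Ox xG' xG leadG kap_e leadf Pf0.
(* T bounds the denominators; adding k0 makes room for the value of f. Each power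
   gains e - kap >= 1, so the exponent e T + 1 outweighs the fixed loss e T. *)
have [n [T0 [pn bd]]] := OKloc_bounded_powers xG' Ox.
pose T := (T0 + k0)%N; pose N := (e * T).+1.
have [H0 EH0] := bd N; pose H := p%:R ^+ k0 * H0.
have EH : p%:R ^+ T * n%:R ^+ N * x ^+ N = ev H.
  rewrite /H [RHS]rmorphM /= -EH0 rmorphXn rmorph_nat /T exprD; ring.
move: H EH => H EH.
have [k Ek] : exists k, p%:R ^+ T * n%:R ^+ N * G ^+ N
    - p%:R ^+ (nu.+1 * N) * phi ^+ (J * N) * H = f * k.
  apply: (ev_eq0 f_monic f_irr theta_root).
  rewrite rmorphB !rmorphM !rmorphXn !rmorph_nat /= -xG -EH !exprMn !exprM.
  ring.
have lc g : initial 0 g (red g)%:P by apply: (initial_const M).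
exists N.
have pE : (e * T + (h * J + e * nu + kap) * N < e * (nu.+1 * N) + h * (J * N))%N.
  suff: (e * T < (e - kap) * N)%N by rewrite mulnBl; nia.
  have : (0 < e - kap)%N by rewrite subn_gt0.
  by rewrite /N; nia.
have L : initial (e * T + (h * J + e * nu + kap) * N) (f * k) ((red n%:R ^+ N)%:P * P ^+ N).
  rewrite -Ek -[X in initial _ _ X]addr0. apply: initialD.
    have := initialM (initialM (initialX M T (initial_p M)) (initialX M N (lc n%:R))) (initialX M N leadG).
    by rewrite expr1n mul1r mul0n addn0 -polyC_exp.
  rewrite -[X in initial _ _ X]oppr0; apply: initialN.
  apply: (initial_lt M pE).
  have := initialM (initialM (initialX M (nu.+1 * N) (initial_p M)) (initialX M (J * N) (initial_phi M))) (lc H).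
  by rewrite addn0; apply.
have k0_le : (k0 <= e * T + (h * J + e * nu + kap) * N)%N by rewrite /T; nia.
rewrite -(subnKC k0_le) in L; have [Q EQ] := initial_divides M leadf Pf0 L.
have n0 : red n%:R ^+ N != 0 by rewrite expf_neq0 // red_nat_neq0.
by rewrite -(dvdpZr _ _ n0) -mul_polyC EQ dvdp_mulIl.
Qed.

End Core.

(** * Newton polygons *)

Lemma side_e_gt0 p phi f h e s d : np_side p phi f h e s d -> (0 < e)%N.
Proof. by case=> -[]. Qed.

Section Polygon.

Variables (p : nat) (phi f : {poly int}) (ell : nat).
Local Notation u i := (vp p (dev phi f i)).
Local Notation supp := (dev_supp phi f).
Local Notation Y := (np_ord p phi f).

Hypothesis supp0 : 0%N \in supp.
Hypothesis supp_ell : ell \in supp.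
Hypothesis u_ell : u ell = 0%N.
Hypothesis u_gt0 : forall i, i \in supp -> (i < ell)%N -> (0 < u i)%N.

Lemma chordE a b j : (a < b)%N ->
  chord p phi f a b j * (b%:R - a%:R)
    = (u a)%:R * (b%:R - j%:R) + (u b)%:R * (j%:R - a%:R).
Proof.
move=> ab; have ab_neq0 : (b%:R - a%:R : rat) != 0.
  by rewrite subr_eq0 eqr_nat gtn_eqF.
by rewrite /chord; field.
Qed.

Lemma chord_id a j : chord p phi f a a j = (u a)%:R.
Proof. by rewrite /chord !subrr !mul0r addr0. Qed.

(** The ordinate of a chord is a convex combination of those of its ends. *)
Lemma chord_ge (e h k : rat) a b j : (a <= j <= b)%N -> 0 < e ->
  k <= e * (u a)%:R + h * a%:R -> k <= e * (u b)%:R + h * b%:R ->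
  k <= e * chord p phi f a b j + h * j%:R.
Proof.
case/andP=> aj jb e0 ka kb.
have [ab|] := ltnP a b; last first.
  move=> ba; have ja : j = a by lia. have ba' : b = a by lia.
  by rewrite ba' ja chord_id.
have := chordE j ab; set c := chord _ _ _ _ _ _ => cE.
have ajR : (a%:R : rat) <= j%:R by rewrite ler_nat.
have jbR : (j%:R : rat) <= b%:R by rewrite ler_nat.
have abR : (a%:R : rat) < b%:R by rewrite ltr_nat.
rewrite -subr_ge0 -(pmulr_rge0 _ (_ : 0 < b%:R - a%:R)) ?subr_gt0 //.
have -> : (b%:R - a%:R) * (e * c + h * j%:R - k)
   = (e * (u a)%:R + h * a%:R - k) * (b%:R - j%:R)
     + (e * (u b)%:R + h * b%:R - k) * (j%:R - a%:R).
  have -> : (b%:R - a%:R) * (e * c + h * j%:R - k)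
    = e * (c * (b%:R - a%:R)) + (b%:R - a%:R) * (h * j%:R - k) by ring.
  by rewrite cE; ring.
by apply: addr_ge0; apply: mulr_ge0; rewrite subr_ge0.
Qed.

Lemma chord_gt (e h k : rat) a b j : (a <= j <= b)%N -> 0 < e ->
  (j < b)%N || (a == b) ->
  k < e * (u a)%:R + h * a%:R -> k <= e * (u b)%:R + h * b%:R ->
  k < e * chord p phi f a b j + h * j%:R.
Proof.
case/andP=> aj jb e0 jbs ka kb.
have [ab|] := ltnP a b; last first.
  move=> ba; have ja : j = a by lia. have ba' : b = a by lia.
  by rewrite ba' ja chord_id.
have {jbs} jlb : (j < b)%N by case/orP: jbs => // /eqP; lia.
have := chordE j ab; set c := chord _ _ _ _ _ _ => cE.
have ajR : (a%:R : rat) <= j%:R by rewrite ler_nat.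
have jbR : (j%:R : rat) < b%:R by rewrite ltr_nat.
have abR : (a%:R : rat) < b%:R by rewrite ltr_nat.
rewrite -subr_gt0 -(pmulr_rgt0 _ (_ : 0 < b%:R - a%:R)) ?subr_gt0 //.
have -> : (b%:R - a%:R) * (e * c + h * j%:R - k)
   = (e * (u a)%:R + h * a%:R - k) * (b%:R - j%:R)
     + (e * (u b)%:R + h * b%:R - k) * (j%:R - a%:R).
  have -> : (b%:R - a%:R) * (e * c + h * j%:R - k)
    = e * (c * (b%:R - a%:R)) + (b%:R - a%:R) * (h * j%:R - k) by ring.
  by rewrite cE; ring.
by apply: ltr_wpDr; [apply: mulr_ge0; rewrite subr_ge0 | apply: mulr_gt0; rewrite subr_gt0].
Qed.

Lemma np_attained j : (j <= ell)%N -> exists a b,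
  [/\ a \in supp, b \in supp, (a <= j <= b)%N & Y j = chord p phi f a b j].
Proof. by move=> jl; apply: (np_ord_attained p supp0 supp_ell); rewrite jl. Qed.

Lemma np_ge0 j : (j <= ell)%N -> 0 <= Y j.
Proof.
case/np_attained=> a [b [_ _ jab ->]].
have := @chord_ge 1 0 0 a b j jab ltr01.
by rewrite !mul1r !mul0r !addr0 !ler0n; apply.
Qed.

Lemma np_le_u i : i \in supp -> Y i <= (u i)%:R.
Proof. by move=> si; rewrite -(chord_id i i); apply: np_ord_le; rewrite ?leqnn. Qed.

Lemma np_ell : Y ell = 0.
Proof.
apply/eqP; rewrite eq_le np_ge0 // andbT.
by have := np_le_u supp_ell; rewrite u_ell.
Qed.

Lemma np_ge_line (e h k : nat) j : (j <= ell)%N -> (0 < e)%N ->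
  (forall i, i \in supp -> (k <= e * u i + h * i)%N) ->
  k%:R <= e%:R * Y j + h%:R * j%:R.
Proof.
move=> jl e0 H; have [a [b [sa sb jab ->]]] := np_attained jl.
by apply: chord_ge; rewrite ?ltr0n // -!natrM -natrD ler_nat H.
Qed.

Section Side.
Variables h e s d : nat.
Hypothesis side : np_side p phi f h e s d.
Let k0 := (e * u s + h * s)%N.

Lemma side_ge i : i \in supp -> (k0 <= e * u i + h * i)%N.
Proof. by case: side => _ _ _ _ H /H[]. Qed.

Lemma side_np_ge j : (j <= ell)%N -> k0%:R <= e%:R * Y j + h%:R * j%:R.
Proof. by move=> jl; apply: np_ge_line => //; [apply: side_e_gt0 side|apply: side_ge]. Qed.

(** To the left of s every point of the development lies strictly above the line of
the side, and a chord over j < s has its left end there. *)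
Lemma side_np_gt j : (j < s)%N -> (s <= ell)%N -> k0%:R < e%:R * Y j + h%:R * j%:R.
Proof.
move=> js sl; have [|a [b [sa sb jab ->]]] := @np_attained j; first by lia.
have [_ _ _ _ H] := side.
have gt_left i : i \in supp -> (i < s)%N -> (k0 < e * u i + h * i)%N.
  move=> si ils; have [ge_i eq_i] := H i si; rewrite ltn_neqAle ge_i andbT.
  by apply/eqP => E; have := eq_i (esym E); lia.
have gt_a : (k0%:R : rat) < e%:R * (u a)%:R + h%:R * a%:R.
  by rewrite -!natrM -natrD ltr_nat gt_left //; lia.
have ge_b : (k0%:R : rat) <= e%:R * (u b)%:R + h%:R * b%:R.
  by rewrite -!natrM -natrD ler_nat side_ge.
have [jb|bj] := ltnP j b; last have Eb : b = j by lia.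
  by apply: chord_gt; rewrite ?jb ?ltr0n ?(side_e_gt0 side).
have gt_b : (k0%:R : rat) < e%:R * (u b)%:R + h%:R * b%:R.
  by rewrite -!natrM -natrD ltr_nat gt_left // Eb.
have [Eab|nab] := eqVneq a b.
  by rewrite Eab chord_id -Eb.
have ab : (a < b)%N by lia.
have -> : chord p phi f a b j = (u b)%:R.
  have ab0 : (b%:R - a%:R : rat) != 0 by rewrite subr_eq0 eqr_nat gtn_eqF.
  by apply: (mulIf ab0); rewrite chordE // -Eb subrr mulr0 add0r.
by rewrite -Eb.
Qed.

Lemma side_np_eq j : (s <= j <= s + d * e)%N -> (j <= ell)%N ->
  e%:R * Y j + h%:R * j%:R = k0%:R.
Proof.
move=> sj jl; apply/eqP; rewrite eq_le side_np_ge // andbT.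
have [[h0 e0 cop d0] ss sE kE _] := side.
have le_c := @np_ord_le p phi f s (s + d * e) j ss sE sj.
have e0R : (0 : rat) < e%:R by rewrite ltr0n.
apply: le_trans (_ : e%:R * chord p phi f s (s + d * e) j + h%:R * j%:R <= _).
  by rewrite lerD2r ler_pM2l.
have se : (s < s + d * e)%N by nia.
have := chordE j se; set c := chord _ _ _ _ _ _; set E := (s + d * e)%N in kE se *.
move=> cE.
have kER : e%:R * (u E)%:R + h%:R * E%:R = k0%:R :> rat.
  by rewrite -!natrM -natrD kE.
have ksR : e%:R * (u s)%:R + h%:R * s%:R = k0%:R :> rat.
  by rewrite -!natrM -natrD.
have sE0 : (E%:R - s%:R : rat) != 0 by rewrite subr_eq0 eqr_nat gtn_eqF.
rewrite le_eqVlt; apply/orP; left; apply/eqP; apply: (mulIf sE0).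
have -> : (e%:R * c + h%:R * j%:R) * (E%:R - s%:R)
   = e%:R * (c * (E%:R - s%:R)) + h%:R * j%:R * (E%:R - s%:R) by ring.
rewrite cE.
have -> : e%:R * ((u s)%:R * (E%:R - j%:R) + (u E)%:R * (j%:R - s%:R)) + h%:R * j%:R * (E%:R - s%:R)
  = (e%:R * (u s)%:R + h%:R * s%:R) * (E%:R - j%:R) + (e%:R * (u E)%:R + h%:R * E%:R) * (j%:R - s%:R) :> rat by ring.
rewrite kER ksR; ring.
Qed.

End Side.

(** The ends of the side are the first and the last points on the line; the line
decreases, so after ell it runs below 0, hence below the points. *)
Lemma side_of_line h e a b : (0 < h)%N -> (0 < e)%N -> coprime h e ->
    (a < b)%N -> a \in supp -> b \in supp ->
    (forall i, i \in supp -> (e * u a + h * a <= e * u i + h * i)%N) ->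
    (e * u b + h * b = e * u a + h * a)%N ->
  exists s d, [/\ np_side p phi f h e s d, (s <= a)%N, (b <= s + d * e)%N
                 & (s + d * e <= ell)%N].
Proof.
move=> h0 e0 cop ab sa sb line kb.
pose k0 := (e * u a + h * a)%N.
pose on i := (i \in supp) && (e * u i + h * i == k0)%N.
have on_a : on a by rewrite /on sa eqxx.
have on_b : on b by rewrite /on sb kb /= eqxx.
have ex_on : exists i, on i by exists a.
have on_bd i : on i -> (i <= size f)%N.
  by case/andP; rewrite mem_filter mem_iota => /andP[_ /andP[_ /ltnW]].
have [s /andP[ss /eqP ks] s_min] := ex_minnP ex_on.
have [s' /andP[ss' /eqP ks'] s_max] := ex_maxnP ex_on on_bd.
have sa_le := s_min _ on_a; have bs_le := s_max _ on_b.
have e_dvd : (e %| s' - s)%N.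
  have : (e %| h * (s' - s))%N.
    have -> : (h * (s' - s) = e * (u s - u s'))%N by nia.
    exact: dvdn_mulr.
  by rewrite mulnC Gauss_dvdl // coprime_sym.
pose d := ((s' - s) %/ e)%N.
have s'E : (s + d * e = s')%N by rewrite /d divnK // subnKC //; lia.
exists s, d; rewrite s'E; split=> //; last first.
- have := line _ supp_ell; rewrite u_ell -/k0 -ks' muln0 => H.
  by rewrite -(leq_pmul2l h0); lia.
split; rewrite ?s'E ?ks ?ks' //.
  by split=> //; rewrite /d divn_gt0 //; apply: dvdn_leq => //; lia.
move=> i si; split; first exact: line.
by move=> ki; rewrite s_min ?s_max // /on si ki eqxx.
Qed.

(** The supporting line is the chord of least height above the abscissa j - 1/2: a
point below this chord would give a lower one. *)
Lemma side_exists j : (0 < j <= ell)%N ->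
  exists h e s d, [/\ np_side p phi f h e s d, (s < j <= s + d * e)%N
                    & (s + d * e <= ell)%N].
Proof.
case/andP=> j0 jl.
pose t : rat := j%:R - 2%:R^-1.
pose c (x : nat * nat) : rat :=
  ((u x.1)%:R * (x.2%:R - t) + (u x.2)%:R * (t - x.1%:R)) / (x.2%:R - x.1%:R).
pose prs := [seq x <- [seq (a, b) | a <- supp, b <- supp] | (x.1 < j <= x.2)%N].
have prsP a b : ((a, b) \in prs) = [&& a \in supp, b \in supp, (a < j)%N & (j <= b)%N].
  rewrite mem_filter /= andbC; apply/andP/and4P => [[]|[sa sb aj jb]].
    by case/allpairsP=> -[x y] /= [sx sy [-> ->]] /andP[].
  by rewrite aj jb; split=> //; apply/allpairsP; exists (a, b).
(* The half-integer t is never an end of a chord, so that replacing one end of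
   the minimal chord changes its height at t strictly. *)
have [a [b [sa sb aj jb cmin]]] : exists a b, [/\ a \in supp, b \in supp, (a < j)%N, (j <= b)%N
    & forall x, x \in prs -> c (a, b) <= c x].
  have : seqmin 0 (map c prs) \in map c prs.
    apply: seqmin_mem; rewrite -size_eq0 size_map size_eq0.
    have : (0%N, ell) \in prs by rewrite prsP supp0 supp_ell j0 jl.
    by apply: contraTneq => ->.
  case/mapP=> -[a b]; rewrite prsP => /and4P[sa sb aj jb] E.
  by exists a, b; split=> // x px; rewrite -E; apply: seqmin_le; apply: map_f.
have ltR (m n : nat) : (m < n)%N -> m%:R + 1 <= n%:R :> rat.
  by move=> mn; rewrite natr1 ler_nat.
have leR (m n : nat) : (m <= n)%N -> m%:R <= n%:R :> rat by rewrite ler_nat.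
have below i : i \in supp ->
    (u a)%:R * (b%:R - i%:R) + (u b)%:R * (i%:R - a%:R) <= (u i)%:R * (b%:R - a%:R) :> rat.
  move=> si; have aj' := ltR _ _ aj; have jb' := leR _ _ jb.
  have ba0 : 0 < b%:R - a%:R :> rat by lra.
  have [ij|ji] := ltnP i j.
    have /cmin : (i, b) \in prs by rewrite prsP si sb ij jb.
    have ij' := ltR _ _ ij; have bi0 : 0 < b%:R - i%:R :> rat by lra.
    have bt : 0 < b%:R - t by rewrite /t; lra.
    rewrite /c /= ler_pdivrMr // mulrAC ler_pdivlMr // => H.
    rewrite -(ler_pM2r bt); nra.
  have /cmin : (a, i) \in prs by rewrite prsP si sa aj ji.
  have ji' := leR _ _ ji; have ia0 : 0 < i%:R - a%:R :> rat by lra.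
  have ta : 0 < t - a%:R by rewrite /t; lra.
  rewrite /c /= ler_pdivrMr // mulrAC ler_pdivlMr // => H.
  rewrite -(ler_pM2r ta); nra.
have ab : (a < b)%N by apply: leq_trans jb.
have al : (a < ell)%N by apply: leq_trans jl.
have ua0 := u_gt0 sa al.
have uba : (u b < u a)%N.
  have := below _ supp_ell; rewrite u_ell mul0r.
  have [//|uab] := ltnP (u b) (u a).
  have := leR _ _ uab; have : 0 < (u a)%:R :> rat by rewrite ltr0n.
  have := ltR _ _ al; have := ltR _ _ ab; nra.
pose D := (u a - u b)%N; pose W := (b - a)%N.
pose g := gcdn D W; pose h := (D %/ g)%N; pose e := (W %/ g)%N.
have D0 : (0 < D)%N by rewrite subn_gt0.
have W0 : (0 < W)%N by rewrite subn_gt0.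
have g0 : (0 < g)%N by rewrite gcdn_gt0 D0.
have DE : D = (h * g)%N by rewrite /h divnK ?dvdn_gcdl.
have WE : W = (e * g)%N by rewrite /e divnK ?dvdn_gcdr.
have h0 : (0 < h)%N by move: D0; rewrite DE muln_gt0 => /andP[].
have e0 : (0 < e)%N by move: W0; rewrite WE muln_gt0 => /andP[].
have cop : coprime h e.
  by rewrite /coprime -(eqn_pmul2r g0) muln_gcdl -DE -WE mul1n.
pose k0 := (e * u a + h * a)%N.
have line i : i \in supp -> (k0 <= e * u i + h * i)%N.
  move=> si; have := below i si; rewrite -subr_ge0.
  have -> : (u i)%:R * (b%:R - a%:R) - ((u a)%:R * (b%:R - i%:R) + (u b)%:R * (i%:R - a%:R))
    = ((W * u i + D * i)%:R - (W * u a + D * a)%:R : rat).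
    by rewrite !natrD !natrM /W /D !natrB 1?ltnW //; ring.
  rewrite subr_ge0 ler_nat WE DE /k0 => H.
  by rewrite -(leq_pmul2r g0); lia.
have kb : (e * u b + h * b = k0)%N.
  apply/eqP; rewrite -(eqn_pmul2r g0) /k0; apply/eqP.
  transitivity (W * u b + D * b)%N; first by rewrite WE DE; lia.
  transitivity (W * u a + D * a)%N; last by rewrite WE DE; lia.
  have bE : b = (a + W)%N by rewrite subnKC // ltnW.
  have uE : u a = (u b + D)%N by rewrite subnKC // ltnW.
  by rewrite [X in (_ + D * X)%N]bE uE !mulnDr; lia.
have [s [d [sd ss bs sl]]] := side_of_line h0 e0 cop ab sa sb line kb.
exists h, e, s, d; split=> //; rewrite (leq_trans jb bs) andbT.
exact: leq_ltn_trans ss aj.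
Qed.

(** The drops Y i.-1 - Y i and Y j - Y j.+1 are the slopes h / e of the sides above
them, and the line of each side lies below the points of the other. *)
Lemma np_convex i j : (0 < i <= j)%N -> (j < ell)%N -> Y i + Y j <= Y i.-1 + Y j.+1.
Proof.
case/andP=> i0 ij jl.
have [|h [e [s [d [sd /andP[si is'] s'l]]]]] := @side_exists i; first by lia.
have [|h2 [e2 [s2 [d2 [sd2 /andP[sj js'] s2'l]]]]] := @side_exists j.+1; first by lia.
have e0 := side_e_gt0 sd; have e20 := side_e_gt0 sd2.
have E1 : e%:R * Y i + h%:R * i%:R = (e * u s + h * s)%:R.
  by apply: (side_np_eq sd); lia.
have E2 : e%:R * Y i.-1 + h%:R * i.-1%:R = (e * u s + h * s)%:R.
  by apply: (side_np_eq sd); lia.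
have E3 : e2%:R * Y j + h2%:R * j%:R = (e2 * u s2 + h2 * s2)%:R.
  by apply: (side_np_eq sd2); lia.
have E4 : e2%:R * Y j.+1 + h2%:R * j.+1%:R = (e2 * u s2 + h2 * s2)%:R.
  by apply: (side_np_eq sd2); lia.
have I1 : (e * u s + h * s)%:R <= e%:R * Y j.+1 + h%:R * j.+1%:R by apply: (side_np_ge sd); lia.
have I2 : (e2 * u s2 + h2 * s2)%:R <= e2%:R * Y i + h2%:R * i%:R by apply: (side_np_ge sd2); lia.
have iE : i.-1%:R = i%:R - 1 :> rat by rewrite -subn1 natrB.
have jE : j.+1%:R = j%:R + 1 :> rat by rewrite -natr1.
rewrite iE in E2; rewrite jE in E4 I1.
have ijR : i%:R <= j%:R :> rat by rewrite ler_nat.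
have e0R : 0 < e%:R :> rat by rewrite ltr0n.
have e20R : 0 < e2%:R :> rat by rewrite ltr0n.
move: (Y i) (Y i.-1) (Y j) (Y j.+1) E1 E2 E3 E4 I1 I2 => a b c d' E1 E2 E3 E4 I1 I2.
have A1 : e%:R * (b - a) = h%:R by lra.
have A2 : e2%:R * (c - d') = h2%:R by lra.
have A3 : e%:R * (a - d') <= e%:R * (b - a) * (j%:R + 1 - i%:R) by rewrite A1; lra.
have A4 : e2%:R * (c - d') * (j%:R + 1 - i%:R) <= e2%:R * (a - d') by rewrite A2; lra.
have B3 : a - d' <= (b - a) * (j%:R + 1 - i%:R).
  by rewrite -(ler_pM2l e0R) mulrA.
have B4 : (c - d') * (j%:R + 1 - i%:R) <= (a - d').
  by rewrite -(ler_pM2l e20R) mulrA.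
have : (c - d') <= (b - a).
  have n0 : 0 < j%:R + 1 - i%:R :> rat by lra.
  by rewrite -(ler_pM2r n0); lra.
lra.
Qed.

Lemma np_decr i j : (i < j <= ell)%N -> Y j < Y i.
Proof.
case/andP=> ij jl.
have step t : (0 < t <= ell)%N -> Y t < Y t.-1.
  move=> tl; have [h [e [s [d [sd /andP[st ts'] s'l]]]]] := side_exists tl.
  have e0R : 0 < e%:R :> rat by rewrite ltr0n (side_e_gt0 sd).
  have E1 : e%:R * Y t + h%:R * t%:R = (e * u s + h * s)%:R.
    by apply: (side_np_eq sd); lia.
  have E2 : e%:R * Y t.-1 + h%:R * t.-1%:R = (e * u s + h * s)%:R.
    by apply: (side_np_eq sd); lia.
  have tE : t.-1%:R = t%:R - 1 :> rat by rewrite -subn1 natrB //; case/andP: tl.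
  have h0 : 0 < h%:R :> rat by rewrite ltr0n; case: sd => -[].
  rewrite tE in E2; rewrite -(ltr_pM2l e0R); lra.
elim: j ij jl => // j IH; rewrite ltnS leq_eqVlt => /orP[/eqP->|ij] jl.
  by have := step j.+1; rewrite jl => /(_ isT).
apply: lt_trans (IH ij (ltnW jl)).
by have := step j.+1; rewrite jl => /(_ isT).
Qed.

Section SideMonotone.
Variables h e s d : nat.
Hypothesis side : np_side p phi f h e s d.
Hypothesis s'_ell : (s + d * e <= ell)%N.
Let k0 := (e * u s + h * s)%N.
Let D (i : nat) : rat := e%:R * Y i + h%:R * i%:R.

(** The drop of Y at s.-1 exceeds h / e, and by convexity the earlier ones are not
smaller. *)
Lemma side_decr i j : (i < j <= s)%N -> D j < D i.
Proof.
case/andP=> ij js.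
have e0R : 0 < e%:R :> rat by rewrite ltr0n (side_e_gt0 side).
have step t : (0 < t <= s)%N -> D t < D t.-1.
  move=> ts; have Ds : D s = k0%:R by apply: (side_np_eq side); lia.
  have Ds1 : k0%:R < D s.-1 by apply: (side_np_gt side); lia.
  have tE : t.-1%:R = t%:R - 1 :> rat by rewrite -subn1 natrB //; lia.
  have sE : s.-1%:R = s%:R - 1 :> rat by rewrite -subn1 natrB //; lia.
  have [->|ts'] := eqVneq t s; first by rewrite Ds.
  have := @np_convex t s.-1; rewrite prednK; last by lia.
  have tl : (0 < t <= s.-1)%N by lia. have sl : (s <= ell)%N by lia.
  move=> /(_ tl sl) cv.
  move: Ds1; rewrite -Ds /D tE sE; move: (Y s) (Y s.-1) (Y t) (Y t.-1) cv => a b c g.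
  by rewrite -(ler_pM2l e0R) => *; lra.
elim: j ij js => // j IH; rewrite ltnS leq_eqVlt => /orP[/eqP->|ij] js.
  by have := step j.+1; rewrite js => /(_ isT).
apply: lt_trans (IH ij (ltnW js)).
by have := step j.+1; rewrite js => /(_ isT).
Qed.

(** The drop of Y after s is at most h / e, and by convexity the later ones are not
larger. *)
Lemma side_incr i j : (s < j <= i)%N -> (i <= ell)%N -> D j <= D i.
Proof.
case/andP=> sj ji il.
have e0R : 0 < e%:R :> rat by rewrite ltr0n (side_e_gt0 side).
have step t : (s < t < ell)%N -> D t <= D t.+1.
  move=> ts; have Ds : D s = k0%:R by apply: (side_np_eq side); lia.
  have Ds1 : k0%:R <= D s.+1 by apply: (side_np_ge side); lia.
  have tE : t.+1%:R = t%:R + 1 :> rat by rewrite natr1.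
  have sE : s.+1%:R = s%:R + 1 :> rat by rewrite natr1.
  have := @np_convex s.+1 t.
  have tl : (0 < s.+1 <= t)%N by lia. have sl : (t < ell)%N by lia.
  move=> /(_ tl sl) /= cv.
  move: Ds1; rewrite -Ds /D tE sE; move: (Y s) (Y s.+1) (Y t) (Y t.+1) cv => a b c g.
  by rewrite -(ler_pM2l e0R) => *; lra.
elim: i ji il => [|i IH]; first by rewrite leqn0 => /eqP->.
rewrite leq_eqVlt => /orP[/eqP->//|]; rewrite ltnS => ji il.
apply: le_trans (IH ji (ltnW il)) _; apply: step; lia.
Qed.

Lemma side_left_lt i j : i \in supp -> (i < j <= s)%N ->
  D j < (e * u i + h * i)%:R.
Proof.
move=> si ij; apply: lt_le_trans (side_decr ij) _.
by rewrite natrD !natrM lerD2r ler_pM2l ?ltr0n ?(side_e_gt0 side) // np_le_u.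
Qed.

Lemma side_right_le i j : i \in supp -> (s < j <= i)%N -> (j <= ell)%N ->
  D j <= (e * u i + h * i)%:R.
Proof.
move=> si sji jl; rewrite natrD !natrM; have [il|li] := leqP i ell.
  apply: le_trans (side_incr sji il) _.
  by rewrite lerD2r ler_pM2l ?ltr0n ?(side_e_gt0 side) // np_le_u.
have sjl : (s < j <= ell)%N by lia.
apply: le_trans (side_incr sjl (leqnn _)) _.
rewrite /D np_ell mulr0 add0r; apply: ler_wpDl; first by rewrite -natrM ler0n.
by rewrite -!natrM ler_nat leq_mul2l (ltnW li) orbT.
Qed.

End SideMonotone.

End Polygon.

(** * phi-adic developments modulo p *)

Section Content.

Variable p : nat.
Hypothesis p_prime : prime p.

Definition unit_part (a : {poly int}) : {poly int} :=
  map_poly (fun c : int => (c %/ (p ^ vp p a)%:Z)%Z) a.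

Lemma vp_dvd_coef (a : {poly int}) i : ((p ^ vp p a)%:Z %| a`_i)%Z.
Proof.
have [->|ai0] := eqVneq a`_i 0; first exact: dvdz0.
rewrite dvdzE absz_nat pfactor_dvdn ?absz_gt0 // -leEnat; apply: seqmin_le.
apply/mapP; exists a`_i => //; rewrite mem_filter ai0 mem_nth //.
by apply: contraR ai0; rewrite -leqNgt => /(nth_default 0) ->.
Qed.

Lemma unit_partE (a : {poly int}) : a = p%:R ^+ vp p a * unit_part a.
Proof.
apply/polyP => i; rewrite -natrX -polyC_natr coefCM coef_map_id0 ?div0z // mulrC natz.
by rewrite divzK // vp_dvd_coef.
Qed.

Lemma unit_part_redp (a : {poly int}) : a != 0 -> redp p (unit_part a) != 0.
Proof.
move=> a0; have : vp p a \in [seq logn p `|c|%N | c <- a & c != 0].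
  apply: seqmin_mem; rewrite -size_eq0 size_map size_eq0.
  have : lead_coef a \in [seq c <- a | c != 0].
    by rewrite mem_filter lead_coef_eq0 a0 lead_coefE mem_nth // ltn_predL size_poly_gt0.
  by apply: contraTneq => ->.
case/mapP=> c; rewrite mem_filter => /andP[c0 /(nthP 0)[i si ci]] vE.
apply/eqP => /polyP/(_ i); rewrite /redp coef_map coef0 => /eqP.
rewrite (intr_Fp_eq0 p_prime) coef_map_id0 ?div0z // ci => /dvdzP[k Ek].
have cE : c = k * p%:Z * (p ^ vp p a)%:Z by rewrite -Ek divzK // -ci vp_dvd_coef.
have : (p ^ (vp p a).+1 %| `|c|)%N.
  by rewrite cE !abszM /= -mulnA -expnS dvdn_mull.
by rewrite pfactor_dvdn ?absz_gt0 // vE ltnn.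
Qed.

Lemma vp_gt0 (a : {poly int}) : a != 0 -> redp p a = 0 -> (0 < vp p a)%N.
Proof.
move=> a0 ra; rewrite lt0n; apply: contra_eqN ra => /eqP v0.
by rewrite [a]unit_partE v0 mul1r unit_part_redp.
Qed.

Lemma redp_p : redp p p%:R = 0.
Proof. by apply/(redp_eq0 p_prime); exists 1; rewrite mulr1. Qed.

Lemma vp_eq0 (a : {poly int}) : redp p a != 0 -> vp p a = 0%N.
Proof.
apply: contraNeq; rewrite -lt0n => v0.
rewrite [a]unit_partE rmorphM rmorphXn /= redp_p expr0n gtn_eqF //.
by rewrite mul0r.
Qed.

End Content.

Section Quotients.

Variables (phi f : {poly int}).
Hypothesis phi_monic : phi \is monic.
Hypothesis size_phi : (1 < size phi)%N.

Local Notation q j := (rdivp f (phi ^+ j)).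
Local Notation a j := (dev phi f j).

Lemma quot0 : q 0 = f.
Proof. by rewrite expr0; have := rdivp_eq (monic1 _) f; rewrite rmodp1 addr0 mulr1. Qed.

Lemma size_phiX n : size (phi ^+ n) = ((size phi).-1 * n).+1.
Proof. by rewrite -[LHS]prednK ?size_poly_gt0 ?monic_neq0 ?monic_exp // size_exp. Qed.

(** Writing f in terms of the quotient of q_j by phi exhibits a remainder of degree
less than that of phi^(j+1). *)
Lemma quotS j : q j = q j.+1 * phi + a j.
Proof.
suff -> : q j.+1 = rdivp (q j) phi by rewrite -rdivp_eq.
have mX n : phi ^+ n \is monic by apply: monic_exp.
set Q := q j.
suff Ef : f = rdivp Q phi * phi ^+ j.+1 + (rmodp Q phi * phi ^+ j + rmodp f (phi ^+ j)).
  rewrite {1}Ef rdivp_addl_mul_small // size_phiX (leq_ltn_trans (size_polyD _ _)) //.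
  rewrite gtn_max; apply/andP; split; last first.
    apply: (@leq_trans (size (phi ^+ j))); first by rewrite ltn_rmodp monic_neq0.
    by rewrite size_phiX ltnS leq_mul.
  have [->|nz] := eqVneq (rmodp Q phi) 0; first by rewrite mul0r size_poly0.
  rewrite size_Mmonic // size_phiX addnS /= ltnS mulnS leq_add2r -ltnS prednK ?(ltnW size_phi) //.
  by rewrite ltn_rmodp monic_neq0.
by rewrite addrA exprS mulrA -mulrDl -rdivp_eq // /Q -rdivp_eq.
Qed.

Definition low_part j := \sum_(i < j) a i * phi ^+ i.

Lemma quot_low j : f = q j * phi ^+ j + low_part j.
Proof.
elim: j => [|j IH]; first by rewrite quot0 mulr1 /low_part big_ord0 addr0.
rewrite /low_part big_ord_recr /= {1}IH quotS exprS /low_part; ring.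
Qed.

Lemma quot_eq0 j : (size f <= j)%N -> q j = 0.
Proof.
move=> fj; rewrite rdivp_small // size_phiX ltnS (leq_trans fj) // leq_pmull //.
by case: (size phi) size_phi => [|[]].
Qed.

Lemma dev_eq0 j : (size f <= j)%N -> a j = 0.
Proof. by move=> fj; rewrite /dev quot_eq0 // rmod0p. Qed.

Lemma mem_dev_supp j : (j \in dev_supp phi f) = (a j != 0).
Proof.
rewrite mem_filter mem_iota add0n /=; case: ltnP => [|fj]; first by rewrite andbT.
by rewrite dev_eq0 // eqxx.
Qed.

Lemma quot_high j : q j = \sum_(j <= i < size f) a i * phi ^+ (i - j).
Proof.
have [fj|jf] := leqP (size f) j; first by rewrite quot_eq0 // big_geq.
have H k : (k <= size f)%N -> q (size f - k) = \sum_(size f - k <= i < size f) a i * phi ^+ (i - (size f - k)).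
  elim: k => [|k IH] kf; first by rewrite subn0 quot_eq0 // big_geq.
  have E : (size f - k = (size f - k.+1).+1)%N by rewrite subnS prednK // subn_gt0.
  rewrite big_ltn ?subnn ?mulr1; last by rewrite ltn_subrL /= (leq_trans _ kf).
  rewrite quotS -E IH ?(ltnW kf) // addrC; congr (_ + _).
  rewrite mulr_suml; apply: eq_big_nat => i /andP[ki _].
  rewrite -mulrA -exprSr; congr (_ * phi ^+ _); lia.
have := H (size f - j)%N; rewrite subKn ?(ltnW jf) //; apply; exact: leq_subr.
Qed.

Section ModP.

Variable p : nat.
Hypothesis p_prime : prime p.
Variables (ell : nat) (Psi : {poly 'F_p}).
Hypothesis phi_irr : monic_irreducible_poly (redp p phi).
Hypothesis f_fact : redp p f = redp p phi ^+ ell * Psi.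
Hypothesis Psi_ndvd : ~~ (redp p phi %| Psi).

Lemma redp_small_eq0 (b : {poly int}) : (size b < size phi)%N -> redp p phi %| redp p b -> redp p b = 0.
Proof.
move=> sb dv; apply/eqP; apply: contraTT sb => b0; rewrite -leqNgt.
rewrite -(size_redp_monic p phi_monic); apply: leq_trans (dvdp_leq b0 dv) _.
exact: size_poly.
Qed.

(** Modulo p both f and its quotients are multiples of phi below ell, so the
remainder a_j is a multiple of phi of smaller degree, hence 0. *)
Lemma redp_quot j : (j <= ell)%N -> redp p (q j) = redp p phi ^+ (ell - j) * Psi.
Proof.
have phi0 : redp p phi != 0 by rewrite monic_neq0 // phi_irr.2.
elim: j => [|j IH] jl; first by rewrite quot0 subn0.
have := IH (ltnW jl); rewrite quotS rmorphD rmorphM /= -(subnSK jl) (exprS (redp p phi)) => E.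
have a0 : redp p (a j) = 0.
  apply: redp_small_eq0; first exact: size_dev.
  by rewrite -(dvdp_addr _ (dvdp_mulIr (redp p (q j.+1)) _)) E -mulrA dvdp_mulIl.
apply: (mulIf phi0); move: E; rewrite a0 addr0 => ->; ring.
Qed.

Lemma redp_dev_lt j : (j < ell)%N -> redp p (a j) = 0.
Proof.
move=> jl; have := redp_quot (ltnW jl); rewrite quotS rmorphD rmorphM /= redp_quot //.
rewrite -(subnSK jl) exprSr mulrAC -[RHS]add0r addrC => /addIr.
by [].
Qed.

Lemma redp_dev_ell : redp p (a ell) != 0.
Proof.
apply: contra Psi_ndvd => /eqP a0.
have := redp_quot (leqnn ell); rewrite subnn mul1r => <-.
by rewrite quotS rmorphD rmorphM /= a0 addr0 dvdp_mulIr.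
Qed.

Lemma dev_supp_ell : ell \in dev_supp phi f.
Proof.
rewrite mem_dev_supp; apply: contraNneq redp_dev_ell => ->.
by rewrite rmorph0.
Qed.

Lemma vp_dev_ell : vp p (a ell) = 0%N.
Proof. exact/vp_eq0/redp_dev_ell. Qed.

Lemma vp_dev_lt j : j \in dev_supp phi f -> (j < ell)%N -> (0 < vp p (a j))%N.
Proof. by rewrite mem_dev_supp => a0 jl; apply: vp_gt0 => //; apply: redp_dev_lt. Qed.

Lemma unit_part_red (b : {poly int}) : b != 0 -> (size b < size phi)%N ->
  red phi_irr (unit_part p b) != 0.
Proof.
move=> b0 sb; apply/eqP => /eqP; rewrite (in_qfpoly_eq0 phi_irr) => dv.
have := unit_part_redp p_prime b0; rewrite redp_small_eq0 ?eqxx //.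
by apply: leq_ltn_trans sb; apply: size_poly.
Qed.

End ModP.

End Quotients.

(** * Integrality of the quotients *)

Section Integrality.

Variables (p : nat) (K : fieldExtType rat) (theta : K).
Hypothesis p_prime : prime p.
Variable f : {poly int}.
Hypothesis f_monic : f \is monic.
Hypothesis theta_root : root (map_poly intr f) theta.

Local Notation ev := (eval_at theta).

(** The vector v is an eigenvector, so z is a root of a characteristic polynomial,
which is monic with coefficients in Z[theta]. *)
Lemma integral_of_stable_vector n (A : 'I_n -> 'I_n -> {poly int}) (v : 'I_n -> K) z :
  (forall i, z * v i = \sum_j ev (A i j) * v j) -> (exists i, v i != 0) ->
  integralOver (intr : int -> K) z.
Proof.
move=> Av [i0 vi0].
pose B : 'M[{poly int}]_n := \matrix_(j, i) A i j.
have eigB : eigenvalue (map_mx ev B) z.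
  apply/eigenvalueP; exists (\row_i v i).
    apply/rowP => i; rewrite !mxE Av; apply: eq_bigr => j _.
    by rewrite !mxE mulrC.
  by apply: contraNneq vi0 => /rowP/(_ i0); rewrite !mxE => ->.
rewrite eigenvalue_root_char -map_char_poly in eigB.
apply: integral_root_monic eigB _; first by apply/monic_map/char_poly_monic.
apply/integral_poly => i; rewrite coef_map; exact: (ev_int f_monic theta_root).
Qed.

Variable phi : {poly int}.
Hypothesis phi_monic : phi \is monic.
Hypothesis size_phi : (1 < size phi)%N.
Variable v : nat -> rat.
Local Notation q j := (rdivp f (phi ^+ j)).
Local Notation a j := (dev phi f j).
Local Notation n j := (Num.truncn (v j)).

Hypothesis v_ge0 : forall j, 0 <= v j.
Hypothesis v_le : forall j, a j != 0 -> v j <= (vp p (a j))%:R.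
Hypothesis v_convex : forall i j, (0 < i <= j)%N -> v i + v j <= v i.-1 + v j.+1.

Definition quot_elt j : K := ev (q j) / p%:R ^+ n j.

(** The Z[theta]-module spanned by the normalised quotients. *)
Definition quot_span (x : K) : Prop :=
  exists A : nat -> {poly int}, x = \sum_(l < size f) ev (A l) * quot_elt l.

Lemma pK_neq0 : (p%:R : K) != 0.
Proof. by rewrite natK_eq0 -lt0n prime_gt0. Qed.

Lemma quot_spanD x y : quot_span x -> quot_span y -> quot_span (x + y).
Proof.
move=> [A ->] [B ->]; exists (fun l => A l + B l); rewrite -big_split.
by apply: eq_bigr => l _; rewrite rmorphD mulrDl.
Qed.

Lemma quot_spanM g x : quot_span x -> quot_span (ev g * x).
Proof.
move=> [A ->]; exists (fun l => g * A l); rewrite mulr_sumr.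
by apply: eq_bigr => l _; rewrite rmorphM mulrA.
Qed.

Lemma quot_span0 : quot_span 0.
Proof. by exists (fun=> 0); rewrite big1 // => l _; rewrite rmorph0 mul0r. Qed.

Lemma quot_span_elt j : quot_span (quot_elt j).
Proof.
have [fj|jf] := leqP (size f) j.
  by rewrite /quot_elt quot_eq0 // rmorph0 mul0r; apply: quot_span0.
exists (fun l => if l == j then 1 else 0); rewrite (bigD1 (Ordinal jf)) //= eqxx.
rewrite rmorph1 mul1r big1 ?addr0 // => l; rewrite -val_eqE /= => /negPf->.
by rewrite rmorph0 mul0r.
Qed.

Lemma quot_span_term s i j : s%:R <= v i + v j ->
  exists2 x, quot_span x & ev (a i) * ev (q j) = p%:R ^+ s * x.
Proof.
move=> sv; have [->|ai0] := eqVneq (a i) 0.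
  by exists 0; [apply: quot_span0 | rewrite rmorph0 mul0r mulr0].
exists (ev (unit_part p (a i) * p%:R ^+ (vp p (a i) + n j - s)) * quot_elt j).
  exact/quot_spanM/quot_span_elt.
have le_s : (s <= vp p (a i) + n j)%N.
  rewrite -leq_subLR truncn_ge_nat //; have := v_le ai0.
  have [lt_s _|le_s] := leqP s (vp p (a i)); first by rewrite (eqP lt_s).
  by rewrite natrB 1?ltnW //; lra.
rewrite {1}[a i](unit_partE p_prime) /quot_elt !rmorphM !rmorphXn !rmorph_nat /=.
have -> : p%:R ^+ vp p (a i) = p%:R ^+ s * p%:R ^+ (vp p (a i) + n j - s) / p%:R ^+ n j :> K.
  by rewrite -exprD subnKC // exprD mulfK // expf_neq0 // pK_neq0.
move: (ev _) (ev _) (_ ^+ s) (_ ^+ (_ - s)) (_ ^+ n j)^-1 => x1 x2 x3 x4 x5; ring.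
Qed.

(** Induction on i by the identity
  q_(i+1) q_j = q_i q_(j+1) + a_j q_(i+1) - a_i q_(j+1)   at theta,
in which convexity bounds v_i + v_(j+1) from below by v_(i+1) + v_j; it ends at
q_0 = f = 0. *)
Lemma quotM_span s i j : (i <= j)%N -> s%:R <= v i + v j ->
  exists2 x, quot_span x & ev (q i) * ev (q j) = p%:R ^+ s * x.
Proof.
elim: i j => [|i IH] j ij sv.
  exists 0; first exact: quot_span0.
  by rewrite quot0 (ev_f theta_root) mul0r mulr0.
have cv := @v_convex i.+1 j; rewrite ij /= in cv; have {}cv := cv isT.
have [x1 Lx1 E1] := IH j.+1 (leq_trans (ltnW ij) (leqnSn _)) (le_trans sv cv).
have [x2 Lx2 E2] : exists2 x, quot_span x & ev (a j) * ev (q i.+1) = p%:R ^+ s * x.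
  by apply: quot_span_term; rewrite addrC.
have [x3 Lx3 E3] := quot_span_term (le_trans sv cv).
exists (x1 + x2 - x3).
  apply: quot_spanD; first exact: quot_spanD.
  by rewrite -mulN1r -(rmorphN1 ev); apply: quot_spanM.
rewrite mulrBr mulrDr -E1 -E2 -E3.
have := congr1 ev (quotS f phi_monic size_phi i).
have := congr1 ev (quotS f phi_monic size_phi j).
rewrite !rmorphD !rmorphM /= => -> ->.
move: (ev _) (ev _) (ev _) (ev _) (ev _) => x1' x2' x3' x4' x5'; ring.
Qed.

(** By [quotM_span] multiplication by a normalised quotient preserves the module
that they span. *)
Lemma quot_elt_integral j : integralOver (intr : int -> K) (quot_elt j).
Proof.
have zz i l : quot_span (quot_elt i * quot_elt l).
  wlog il : i l / (i <= l)%N => [H|].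
    by case/orP: (leq_total i l) => /H // +; rewrite mulrC.
  have [|x Lx E] := @quotM_span (n i + n l) i l il.
    by rewrite natrD lerD // truncn_le.
  rewrite /quot_elt; suff -> : ev (q i) / p%:R ^+ n i * (ev (q l) / p%:R ^+ n l) = x by [].
  rewrite mulrACA E -invfM -exprD mulrC mulKf //.
  by rewrite expf_neq0 // pK_neq0.
have [z0|z_neq0] := eqVneq (quot_elt j) 0.
  by rewrite z0; apply: integral0.
have jf : (j < size f)%N.
  by rewrite ltnNge; apply: contra z_neq0 => fj; rewrite /quot_elt quot_eq0 // rmorph0 mul0r.
have [A HA] : exists A : 'I_(size f) -> nat -> {poly int},
    forall l : 'I_(size f), quot_elt j * quot_elt l = \sum_(k < size f) ev (A l k) * quot_elt k.
  have H (l : 'I_(size f)) : exists A : nat -> {poly int},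
      quot_elt j * quot_elt l = \sum_(k < size f) ev (A k) * quot_elt k by apply: zz.
  by have [A HA] := fin_all_exists H; exists A.
apply: (@integral_of_stable_vector _ (fun l k : 'I_(size f) => A l k)
  (fun l : 'I_(size f) => quot_elt l)) => //.
by exists (Ordinal jf).
Qed.

End Integrality.

(** * Polynomials in a power of the variable *)

Lemma sum_arith_prog (V : nmodType) (G : nat -> V) n s e d : (0 < e)%N ->
    (forall k, (k < d)%N -> (s + k * e < n)%N) ->
    (forall i, (i < n)%N -> (forall k, (k < d)%N -> i != (s + k * e)%N) -> G i = 0) ->
  \sum_(i < n) G i = \sum_(k < d) G (s + k * e)%N.
Proof.
move=> e0 lt_n G0.
transitivity (\sum_(i < n) \sum_(k < d) if i == (s + k * e)%N :> nat then G i else 0).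
  apply: eq_bigr => i _; case: (pickP (fun k : 'I_d => i == (s + k * e)%N :> nat)) => [k /eqP ik|none].
    rewrite (bigD1 k) //= ik eqxx big1 ?addr0 // => k' nk.
    by rewrite eqn_add2l eqn_pmul2r // eq_sym val_eqE (negPf nk).
  rewrite big1 => [|k _]; last by rewrite none.
  by apply: G0 => // k kd; have := none (Ordinal kd) => /= ->.
rewrite exchange_big; apply: eq_bigr => k _ /=.
rewrite (bigD1 (Ordinal (lt_n k (ltn_ord k)))) //= eqxx big1 ?addr0 // => i.
by rewrite -val_eqE /= => /negPf->.
Qed.

Section FieldPoly.

Variable F : fieldType.
Implicit Types R B P Q : {poly F}.

Lemma comp_Xn_wide P e n : (size P <= n)%N ->
  P \Po 'X^e = \sum_(i < n) P`_i *: 'X^(i * e).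
Proof.
move=> sP; rewrite comp_polyE [RHS](bigID (fun i : 'I_n => (i < size P)%N)) /=.
rewrite [X in _ + X]big1 ?addr0 => [|i]; last first.
  by rewrite -leqNgt => /(nth_default 0) ->; rewrite scale0r.
rewrite (big_ord_widen n (fun i => P`_i *: 'X^e ^+ i)) //.
by apply: eq_bigr => i _; rewrite -exprM mulnC.
Qed.

Lemma size_comp_Xn P e : (0 < e)%N -> P != 0 -> size (P \Po 'X^e) = ((size P).-1 * e).+1.
Proof.
move=> e0 P0; have sz := size_comp_poly P 'X^e; rewrite size_polyXn /= in sz.
rewrite -sz prednK // size_poly_gt0; apply: contra P0 => /eqP PX0.
apply/eqP/polyP => i; move/polyP/(_ (i * e)%N): PX0.
by rewrite coef_comp_poly_Xn // dvdn_mull // mulnK // !coef0.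
Qed.

(** Division by R commutes with the substitution, up to the degree of the
remainder. *)
Lemma comp_Xn_dvd R B e : (0 < e)%N -> R != 0 ->
  R \Po 'X^e %| B \Po 'X^e -> R %| B.
Proof.
move=> e0 R0; rewrite {1}(divp_eq B R) comp_polyD comp_polyM.
rewrite dvdp_addr ?dvdp_mulIr // => dv.
have [/eqP//|T0] := eqVneq (B %% R) 0.
have := ltn_modp B R; rewrite R0 => szT.
have TX0 : (B %% R) \Po 'X^e != 0.
  by rewrite -size_poly_eq0 size_comp_Xn.
have := dvdp_leq TX0 dv; rewrite !size_comp_Xn // ltnS leq_pmul2r //.
by rewrite leqNgt -ltnS !prednK ?size_poly_gt0 ?szT.
Qed.

(** Write R = r g with g the gcd of R and B.  As R is separable, r is coprime to g,
hence to B; but r divides B^N. *)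
Lemma separable_dvd_exp R B N : separable_poly R -> R %| B ^+ N -> R %| B.
Proof.
move=> sepR RB; pose g := gcdp R B.
have gR : g %| R by apply: dvdp_gcdl.
have /dvdpP[r Er] := gR.
have : coprimep r g by move: sepR; rewrite Er separable_mul => /and3P[].
move=> cop; have copB : coprimep r B.
  apply/Pdiv.Idomain.coprimepP => b br bB.
  have bg : b %| g by rewrite dvdp_gcd bB andbT (dvdp_trans br) // Er dvdp_mulIl.
  by move/Pdiv.Idomain.coprimepP: cop => /(_ b br bg).
have r1 : r %= 1.
  move/Pdiv.Idomain.coprimepP: (coprimep_expr N copB) => /(_ r (dvdpp r)); apply.
  by apply: dvdp_trans RB; rewrite Er dvdp_mulIl.
rewrite Er (eqp_dvdl _ (eqp_mulr g r1)) mul1r; exact: dvdp_gcdr.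
Qed.

(** As R(0) is nonzero, the powers of X can be cancelled, and then R divides B. *)
Lemma ndvd_exp_initial R B (c : F) s a e N : (0 < e)%N -> separable_poly R ->
    R`_0 != 0 -> c != 0 -> B != 0 -> (size B < size R)%N ->
  ~~ ('X^s * (R \Po 'X^e) %| (c%:P * ('X^a * (B \Po 'X^e))) ^+ N).
Proof.
move=> e0 sepR R0 c0 B0 sBR; apply/negP => dv.
have Rn0 : R != 0 by apply: contraNneq R0 => ->; rewrite coef0.
have {}dv := dvdp_trans (dvdp_mulIr _ _) dv.
rewrite !exprMn -polyC_exp mul_polyC dvdpZr ?expf_neq0 // -exprM in dv.
have cop : coprimep (R \Po 'X^e) ('X^(a * N)).
  apply/coprimep_expr; rewrite coprimepX.
  rewrite /root horner_comp hornerXn expr0n gtn_eqF //.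
  by rewrite horner_coef0.
rewrite Gauss_dvdpr // -[_ ^+ N]/((B \Po 'X^e) ^+ N) -rmorphXn /= in dv.
have := separable_dvd_exp sepR (comp_Xn_dvd e0 Rn0 dv).
by move/(dvdp_leq B0); rewrite leqNgt sBR.
Qed.

(** The truncations of R by different numbers of terms have different degrees. *)
Lemma drop_comb_neq0 R d (c : nat -> F) : size R = d.+1 ->
  (exists2 m, (m < d)%N & c m != 0) ->
  \sum_(m < d) c m *: drop_poly m.+1 R != 0.
Proof.
move=> sR ex; have ex' : exists m, (m < d)%N && (c m != 0).
  by case: ex => m md cm; exists m; rewrite md.
have [m /andP[md cm] m_min] := ex_minnP ex'.
have Rd : R`_d != 0 by rewrite -[d]/(d.+1.-1) -sR -lead_coefE lead_coef_eq0 -size_poly_eq0 sR.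
apply: contraNneq (mulf_neq0 cm Rd) => /polyP/(_ (d - m.+1)%N).
rewrite coef0 coef_sum (bigD1 (Ordinal md)) //= coefZ coef_drop_poly subnK // => E.
apply/eqP; rewrite -[RHS]E big1 ?addr0 // => k; rewrite -val_eqE /= => km.
rewrite coefZ coef_drop_poly; have [km'|mk] := ltnP k m.
  have [->|ck] := eqVneq (c k) 0; first by rewrite mul0r.
  by have := m_min k; rewrite ck (ltn_ord k) => /(_ isT); rewrite leqNgt km'.
by rewrite [R`__]nth_default ?mulr0 // sR; lia.
Qed.

Lemma size_drop_comb R d (c : nat -> F) : size R = d.+1 ->
  (size (\sum_(m < d) c m *: drop_poly m.+1 R)%R <= d)%N.
Proof.
move=> sR; apply: (big_ind (fun Q : {poly F} => size Q <= d)%N) => [|P Q sP sQ|m _].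
- by rewrite size_poly0.
- by apply: leq_trans (size_polyD _ _) _; rewrite geq_max sP.
by apply: leq_trans (size_scale_leq _ _) _; rewrite size_drop_poly sR; lia.
Qed.

End FieldPoly.

(** * Ordinates along the principal polygon *)

Section PolygonData.

Variables (p : nat) (phi f : {poly int}) (ell : nat) (Psi : {poly 'F_p}).
Hypothesis p_prime : prime p.
Hypothesis f_monic : f \is monic.
Hypothesis f_irr : irreducible_poly f.
Hypothesis phi_monic : phi \is monic.
Hypothesis phi_irr : monic_irreducible_poly (redp p phi).

Local Notation q j := (rdivp f (phi ^+ j)).
Local Notation a j := (dev phi f j).
Local Notation supp := (dev_supp phi f).
Local Notation Y := (np_ord p phi f).

Let size_phi : (1 < size phi)%N := size_phi_gt1 phi_monic phi_irr.

(** Then phi divides the irreducible polynomial f. *)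
Lemma degenerate_phi : a 0 = 0 -> phi = f.
Proof.
move=> a0; have Ef := quotS f phi_monic size_phi 0; rewrite quot0 a0 addr0 in Ef.
have dv : phi %| f by rewrite Ef dvdp_mulIr.
have := f_irr.2 phi; rewrite gtn_eqF // => /(_ isT dv) eq_phi.
by apply/eqP; rewrite -eqp_monic.
Qed.

Lemma degenerate_dev j : a 0 = 0 -> a j = (j == 1%N)%:R.
Proof.
move=> a0; have E := degenerate_phi a0.
have q1 : q 1 = 1 by rewrite expr1 E rdivpp // (monicP f_monic) expr1n.
have sz : (size (1%R : {poly int}) < size phi)%N by rewrite size_poly1.
case: j => [|[|j]] //.
  by rewrite /dev q1 rmodp_small.
suff q0 : q j.+2 = 0 by rewrite /dev q0 rmod0p.
rewrite rdivp_small // E size_phiX ?E -?E // mulnS mulnS.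
by case: (size phi) size_phi => [|[]] //= n _; lia.
Qed.

Lemma degenerate_np : a 0 = 0 -> Y 1 = 0.
Proof.
move=> a0; have s1 j : (j \in supp) = (j == 1%N).
  by rewrite mem_dev_supp // degenerate_dev //; case: (j =P 1%N); rewrite ?oner_eq0 ?eqxx.
have := @np_ord_attained p phi f 1 1 1; rewrite !s1 => /(_ isT isT isT)[a' [b' []]].
rewrite !s1 => /eqP-> /eqP-> _ ->; rewrite chord_id degenerate_dev //=.
by rewrite (@vp_eq0 p p_prime 1) // rmorph1 oner_eq0.
Qed.

Hypothesis f_fact : redp p f = redp p phi ^+ ell * Psi.
Hypothesis Psi_ndvd : ~~ (redp p phi %| Psi).

Lemma degenerate_ell : a 0 = 0 -> ell = 1%N.
Proof.
move=> a0; have := redp_dev_ell phi_monic size_phi phi_irr f_fact Psi_ndvd.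
by rewrite degenerate_dev //; case: (ell =P 1%N) => // _; rewrite rmorph0 eqxx.
Qed.

(** Prolonging the ordinates by 0 after ell makes the inequalities hold at every
abscissa; when f = phi the polygon is a point and the zero function will do. *)
Lemma polygon_data : exists v : nat -> rat,
  [/\ forall j, 0 <= v j,
      forall j, a j != 0 -> v j <= (vp p (a j))%:R,
      forall i j, (0 < i <= j)%N -> v i + v j <= v i.-1 + v j.+1,
      forall j, (0 < j <= ell)%N -> Y j = v j
    & forall i j, (i < j <= ell)%N -> a i != 0 -> v j < (vp p (a i))%:R].
Proof.
have [a0|a0] := eqVneq (a 0) 0.
  exists (fun=> 0); split=> //.
  - by move=> j; rewrite (degenerate_ell a0) => jl; rewrite -[j](_ : 1 = j)%N ?degenerate_np //; lia.
  - move=> i j; rewrite (degenerate_ell a0) degenerate_dev // => ij.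
    have -> : i = 0%N by lia. by move/eqP.
have s0 : 0%N \in supp by rewrite mem_dev_supp.
have sl := dev_supp_ell phi_monic size_phi phi_irr f_fact Psi_ndvd.
have ul := vp_dev_ell phi_monic size_phi p_prime phi_irr f_fact Psi_ndvd.
have u0 := vp_dev_lt phi_monic size_phi p_prime phi_irr f_fact.
pose v j := if (j <= ell)%N then Y j else 0.
have vl j : (ell <= j)%N -> v j = 0.
  rewrite /v leq_eqVlt => /orP[/eqP<-|]; first by rewrite leqnn; apply: (np_ell s0).
  by rewrite ltnNge => /negPf->.
have v_ge0 j : 0 <= v j by rewrite /v; case: ifP => // jl; apply: (np_ge0 s0 sl).
have v_decr i j : (i < j <= ell)%N -> v j < v i.
  by case/andP=> ij jl; rewrite /v jl (leq_trans (ltnW ij) jl); apply: (np_decr s0 sl); rewrite ?ij.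
have v_le j : a j != 0 -> v j <= (vp p (a j))%:R.
  by move=> aj; rewrite /v; case: ifP => // _; apply: np_le_u; rewrite mem_dev_supp.
exists v; split=> //.
- move=> i j ij; have [jl|lj] := ltnP j ell.
    have := np_convex s0 sl ul u0 ij jl; rewrite /v jl (ltnW jl) !ifT //; lia.
  rewrite (vl j) // (vl j.+1) ?(leqW lj) // !addr0.
  have [il|li] := leqP i ell; last by rewrite (vl i) // ltnW.
  by apply/ltW/v_decr; rewrite il andbT prednK //; lia.
- by move=> j /andP[_ jl]; rewrite /v jl.
- by move=> i j ij ai; apply: lt_le_trans (v_decr i j ij) (v_le i ai).
Qed.

End PolygonData.

(** * Initial forms along a side *)

Section SideInitial.

Variables (p : nat) (phi f : {poly int}) (ell : nat) (Psi : {poly 'F_p}).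
Hypothesis p_prime : prime p.
Hypothesis phi_monic : phi \is monic.
Hypothesis phi_irr : monic_irreducible_poly (redp p phi).

Local Notation F := {poly %/ redp p phi with phi_irr}.
Local Notation red := (red phi_irr).
Local Notation q j := (rdivp f (phi ^+ j)).
Local Notation a j := (dev phi f j).
Local Notation u i := (vp p (dev phi f i)).
Local Notation supp := (dev_supp phi f).
Local Notation Y := (np_ord p phi f).

Let size_phi : (1 < size phi)%N := size_phi_gt1 phi_monic phi_irr.

Variables (e h : nat) (S : comNzRingType)
    (sigma : {rmorphism {poly int} -> S}) (pi : S)
    (rho : {rmorphism S -> {poly F}}).
Hypothesis M : ramified_model e h sigma pi rho.
Local Notation initial := (initial sigma pi rho).

Lemma initial_le E E' g P : (E' <= E)%N -> initial E g P -> exists Q, initial E' g Q.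
Proof.
rewrite leq_eqVlt => /orP[/eqP-> L|lt_E L]; first by exists P.
by exists 0; apply: (initial_lt M lt_E L).
Qed.

Lemma initial_dev_term i k :
  initial (e * u i + h * k) (a i * phi ^+ k) ((red (unit_part p (a i)))%:P * 'X^k).
Proof.
rewrite {2}[a i](unit_partE p_prime).
have := initialM (initialM (initialX M (u i) (initial_p M)) (initial_const M (unit_part p (a i))))
              (initialX M k (initial_phi M)).
by rewrite expr1n mul1r addn0.
Qed.

Lemma initial_devs_le E j n (k : nat -> nat) :
  (forall i, (j <= i < n)%N -> a i != 0 -> (E <= e * u i + h * k i)%N) ->
  exists Q, initial E (\sum_(j <= i < n) a i * phi ^+ k i) Q.
Proof.
move=> H; rewrite big_seq.
elim/big_rec: _ => [|i g]; first by exists 0; apply: initial0.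
rewrite mem_index_iota => ij [Q LQ].
have [ai0|ai0] := eqVneq (a i) 0; first by exists Q; rewrite ai0 mul0r add0r.
have [P LP] := initial_le (H i ij ai0) (initial_dev_term i (k i)).
by exists (P + Q); apply: initialD.
Qed.

Lemma initial_devs_lt E j n (k : nat -> nat) :
  (forall i, (j <= i < n)%N -> a i != 0 -> (E < e * u i + h * k i)%N) ->
  initial E (\sum_(j <= i < n) a i * phi ^+ k i) 0.
Proof.
move=> H; have [|Q LQ] := @initial_devs_le E.+1 j n k; first exact: H.
exact: (initial_lt M (ltnSn E) LQ).
Qed.

Variables s d : nat.
Hypothesis side : np_side p phi f h e s d.
Local Notation k0 := (e * u s + h * s)%N.

(** The coefficient of X^i in the initial form of f. *)
Definition side_coef i : F :=
  if (i \in supp) && (e * u i + h * i == k0)%N then red (unit_part p (a i)) else 0.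

(** The points of the development lie above the line of the side, and exactly those
on it contribute in degree E. *)
Lemma initial_devs_eq E j n J : (E + h * j = k0 + h * J)%N ->
  initial E (\sum_(j <= i < n) a i * phi ^+ (i - j + J))
         (\sum_(j <= i < n) (side_coef i)%:P * 'X^(i - j + J)).
Proof.
move=> EE; rewrite big_seq [X in initial _ _ X]big_seq; apply: initial_sum => i.
rewrite mem_index_iota => /andP[ji _].
have Ei : (E + (e * u i + h * i) = e * u i + h * (i - j + J) + k0)%N.
  have iE : i = (i - j + j)%N by rewrite subnK.
  by rewrite {2}iE !mulnDr; lia.
rewrite /side_coef; have [ai0|ai0] := eqVneq (a i) 0.
  rewrite mem_dev_supp // ai0 eqxx mul0r /= polyC0 mul0r; exact: initial0.
have si : i \in supp by rewrite mem_dev_supp.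
have ge_k := side_ge side si.
rewrite si /=; case: eqP => [ik|nik].
  have -> : E = (e * u i + h * (i - j + J))%N by lia.
  exact: initial_dev_term.
rewrite polyC0 mul0r; apply: (initial_lt M _ (initial_dev_term i _)); lia.
Qed.

Lemma initial_f_side : initial k0 f (\sum_(i < size f) (side_coef i)%:P * 'X^i).
Proof.
have := @initial_devs_eq k0 0 (size f) 0; rewrite !muln0 => /(_ erefl).
have Ef : \sum_(0 <= i < size f) a i * phi ^+ (i - 0 + 0) = f.
  rewrite -[RHS](quot0 phi f) [RHS]quot_high //.
  by apply: eq_bigr => i _; rewrite addn0.
rewrite Ef big_mkord; under eq_bigr do rewrite subn0 addn0.
by [].
Qed.

(** A polynomial congruent to phi^ell q_j modulo f.  Left of the side q_j itself has
too small a value, but q_j phi^j is congruent to minus the remainder of f by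
phi^j, all of whose terms lie above the line of the side. *)
Definition quot_repr j : {poly int} :=
  if (s < j)%N then phi ^+ ell * q j else - (phi ^+ (ell - j) * low_part phi f j).

Lemma quot_reprE j : (j <= ell)%N -> exists b, phi ^+ ell * q j = quot_repr j + f * b.
Proof.
move=> jl; rewrite /quot_repr; case: ltnP => _; first by exists 0; rewrite mulr0 addr0.
exists (phi ^+ (ell - j)); rewrite {3}(quot_low f phi_monic size_phi j).
rewrite -{1}(subnK jl) exprD; ring.
Qed.

Lemma high_reprE j : phi ^+ ell * q j = \sum_(j <= i < size f) a i * phi ^+ (i - j + ell).
Proof.
rewrite quot_high // mulr_sumr; apply: eq_bigr => i _.
by rewrite exprD; ring.
Qed.

Lemma low_reprE j : phi ^+ (ell - j) * low_part phi f j
  = \sum_(0 <= i < j) a i * phi ^+ (ell - j + i).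
Proof.
rewrite /low_part big_mkord mulr_sumr; apply: eq_bigr => i _.
by rewrite exprD; ring.
Qed.

Lemma quot_repr_eq j w : (s < j)%N -> (w + h * j = k0)%N ->
  initial (h * ell + w) (quot_repr j)
    (\sum_(j <= i < size f) (side_coef i)%:P * 'X^(i - j + ell)).
Proof.
move=> sj wk; rewrite /quot_repr sj high_reprE; apply: initial_devs_eq; lia.
Qed.

(** On the line, e divides h (i - s), and h is coprime to e. *)
Lemma side_abscissa i : i \in supp -> (e * u i + h * i = k0)%N ->
  exists2 k, (k < d.+1)%N & i = (s + k * e)%N.
Proof.
move=> si ik; have [[h0 e0 cop d0] ss _ _ /(_ i si)[_ /(_ ik) /andP[si' is']]] := side.
have edvd : (e %| i - s)%N.
  have : (e %| h * (i - s))%N.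
    have -> : (h * (i - s) = e * (u s - u i))%N by rewrite !mulnBr; lia.
    exact: dvdn_mulr.
  by rewrite mulnC Gauss_dvdl // coprime_sym.
exists ((i - s) %/ e)%N; last by rewrite divnK // subnKC.
by rewrite ltnS -(leq_pmul2r e0) divnK //; lia.
Qed.

Lemma side_coef_eq0 i : (forall k, (k < d.+1)%N -> i != (s + k * e)%N) -> side_coef i = 0.
Proof.
move=> H; rewrite /side_coef; case: ifP => // /andP[si /eqP ik].
by have [k kd ik'] := side_abscissa si ik; have := H k kd; rewrite -ik' eqxx.
Qed.

Lemma side_lt_size k : (k < d.+1)%N -> (s + k * e < size f)%N.
Proof.
move=> kd; have [_ _ sE _ _] := side.
apply: (@leq_ltn_trans (s + d * e)); first by rewrite leq_add2l leq_mul2r -ltnS kd orbT.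
by move: sE; rewrite mem_filter mem_iota => /andP[_ /andP[_]].
Qed.

Lemma side_poly_q0 j : (s + d * e < j)%N ->
  \sum_(j <= i < size f) (side_coef i)%:P * 'X^(i - j + ell) = 0 :> {poly F}.
Proof.
move=> sj; rewrite big_nat big1 // => i /andP[ji _].
rewrite side_coef_eq0 ?polyC0 ?mul0r // => k kd; apply/eqP => ik.
have : (k * e <= d * e)%N by rewrite leq_mul2r -ltnS kd orbT.
by lia.
Qed.

Hypothesis f_fact : redp p f = redp p phi ^+ ell * Psi.
Hypothesis Psi_ndvd : ~~ (redp p phi %| Psi).
Hypothesis s'_ell : (s + d * e <= ell)%N.
Hypothesis s0 : 0%N \in supp.
Let sl := dev_supp_ell phi_monic size_phi phi_irr f_fact Psi_ndvd.
Let ul := vp_dev_ell phi_monic size_phi p_prime phi_irr f_fact Psi_ndvd.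
Let u0 := vp_dev_lt phi_monic size_phi p_prime phi_irr f_fact.

Let nat_lt (w j i : nat) : w%:R <= e%:R * Y j ->
  e%:R * Y j + h%:R * j%:R < (e * u i + h * i)%:R -> (w + h * j < e * u i + h * i)%N.
Proof. by move=> H1 H2; rewrite -(ltr_nat rat) [X in X < _]natrD [(h * j)%:R]natrM; lra. Qed.

Let nat_le (w j i : nat) : w%:R <= e%:R * Y j ->
  e%:R * Y j + h%:R * j%:R <= (e * u i + h * i)%:R -> (w + h * j <= e * u i + h * i)%N.
Proof. by move=> H1 H2; rewrite -(ler_nat rat) [X in X <= _]natrD [(h * j)%:R]natrM; lra. Qed.

Let nat_lt' (w j i : nat) : w%:R < e%:R * Y j ->
  e%:R * Y j + h%:R * j%:R <= (e * u i + h * i)%:R -> (w + h * j < e * u i + h * i)%N.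
Proof. by move=> H1 H2; rewrite -(ltr_nat rat) [X in X < _]natrD [(h * j)%:R]natrM; lra. Qed.

(** The value of the representative is at least h ell + e Y_j, with strict
inequality for j <= s because the points before the side lie off its line. *)
Lemma quot_repr_lt j w : (0 < j <= ell)%N -> w%:R <= e%:R * Y j ->
  (s < j)%N ==> (w%:R < e%:R * Y j) -> initial (h * ell + w) (quot_repr j) 0.
Proof.
case/andP=> j0 jl wY; rewrite /quot_repr; case: ltnP => [sj /= wY'|js _].
  rewrite high_reprE; apply: initial_devs_lt => i /andP[ji _] ai.
  have si : i \in supp by rewrite mem_dev_supp.
  have sji : (s < j <= i)%N by rewrite sj.
  have := nat_lt' wY' (side_right_le s0 sl ul u0 side s'_ell si sji jl).
  have iE : i = (i - j + j)%N by rewrite subnK.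
  by rewrite {2}iE !mulnDr; lia.
rewrite low_reprE.
suff /initialN : initial (h * ell + w) (\sum_(0 <= i < j) a i * phi ^+ (ell - j + i)) 0.
  by rewrite oppr0.
apply: initial_devs_lt => i /= ij ai.
have si : i \in supp by rewrite mem_dev_supp.
have ijs : (i < j <= s)%N by rewrite ij.
have := nat_lt wY (side_left_lt s0 sl ul u0 side s'_ell si ijs).
have lE : ell = (ell - j + j)%N by rewrite subnK.
by rewrite {2}lE !mulnDr; lia.
Qed.

Lemma quot_repr_le j w : (0 < j <= ell)%N -> w%:R <= e%:R * Y j ->
  exists Q, initial (h * ell + w) (quot_repr j) Q.
Proof.
move=> jl wY; have [sj|js] := ltnP s j; last first.
  by exists 0; apply: quot_repr_lt => //; rewrite ltnNge js.
rewrite /quot_repr sj high_reprE; apply: initial_devs_le => i /andP[ji _] ai.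
have si : i \in supp by rewrite mem_dev_supp.
have sji : (s < j <= i)%N by rewrite sj.
have jl' : (j <= ell)%N by case/andP: jl.
have := nat_le wY (side_right_le s0 sl ul u0 side s'_ell si sji jl').
have iE : i = (i - j + j)%N by rewrite subnK.
by rewrite {2}iE !mulnDr; lia.
Qed.

Local Notation R := (res_poly f phi_irr e s d).

Lemma side_coefE k : (k < d.+1)%N -> side_coef (s + k * e)%N = R`_k.
Proof.
move=> kd; rewrite coef_poly kd /side_coef /res_coef -/(unit_part p _).
case si: (_ \in _) => //=; congr (if _ then _ else _).
have e0 := side_e_gt0 side.
have sk : (s <= s + k * e <= s + d * e)%N by rewrite leq_addr leq_add2l leq_mul2r -ltnS kd orbT.
have kl : (s + k * e <= ell)%N by lia.
have := side_np_eq s0 sl ul side sk kl; set i := (s + k * e)%N => Yi.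
have e0R : (0 : rat) < e%:R by rewrite ltr0n.
apply/eqP/eqP => [ik|uY].
  apply: (mulfI (lt0r_neq0 e0R)); apply: (addIr (h%:R * i%:R)).
  by rewrite Yi -ik natrD !natrM.
by apply/eqP; rewrite -(eqr_nat rat) -Yi natrD !natrM uY.
Qed.

Lemma size_res_poly_le : (size R <= d.+1)%N.
Proof. exact: size_poly. Qed.

Lemma side_poly_f : \sum_(i < size f) (side_coef i)%:P * 'X^i = 'X^s * (R \Po 'X^e).
Proof.
rewrite (@sum_arith_prog _ (fun i => (side_coef i)%:P * 'X^i) _ s e d.+1) ?(side_e_gt0 side) //.
- rewrite (comp_Xn_wide e size_res_poly_le) mulr_sumr; apply: eq_bigr => k _.
  by rewrite side_coefE // exprD mulrCA mul_polyC.
- exact: side_lt_size.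
by move=> i _ H; rewrite side_coef_eq0 // polyC0 mul0r.
Qed.

(** Only the points of the side from the (m + 1)-st on have abscissa at least j, so
the sum is R deprived of its first m + 1 terms; e - 1 - r is the distance from j
to the next such abscissa. *)
Lemma side_poly_q r m : (r < e)%N -> (m < d)%N ->
  let j := (s.+1 + r + m * e)%N in
  \sum_(j <= i < size f) (side_coef i)%:P * 'X^(i - j + ell)
    = 'X^(ell + (e.-1 - r)) * (drop_poly m.+1 R \Po 'X^e).
Proof.
move=> re md j; have e0 := side_e_gt0 side.
rewrite big_geq_mkord big_mkcond /=.
pose G i := if (j <= i)%N then (side_coef i)%:P * 'X^(i - j + ell) else 0.
rewrite (@sum_arith_prog _ G _ (s + m.+1 * e) e (d - m)) //.
- have sz : (size (drop_poly m.+1 R) <= d - m)%N.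
    by rewrite size_drop_poly; have := size_res_poly_le; lia.
  rewrite (comp_Xn_wide e sz) mulr_sumr; apply: eq_bigr => k _.
  have kd := ltn_ord k; have kd' : (m.+1 + k < d.+1)%N by lia.
  have iE : (s + m.+1 * e + k * e = s + (m.+1 + k) * e)%N by rewrite mulnDl addnA.
  rewrite /G /= iE (side_coefE kd') coef_drop_poly [(k + _)%N]addnC.
  rewrite ifT; last by rewrite /j !mulnDl mulSn; lia.
  have -> : (s + (m.+1 + k) * e - j + ell = ell + (e.-1 - r) + k * e)%N.
    by rewrite /j !mulnDl mulSn; lia.
  by rewrite exprD mulrCA mul_polyC.
- move=> k kd; rewrite -addnA -mulnDl; apply: side_lt_size; lia.
move=> i _ H; rewrite /G; case: ifP => // ji; rewrite side_coef_eq0 ?polyC0 ?mul0r // => k kd.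
apply/eqP => ik; have mk : (m < k)%N.
  rewrite ltnNge; apply/negP => km.
  have : (k * e <= m * e)%N by rewrite leq_mul2r km orbT.
  by rewrite /j in ji; lia.
have kd' : (k - m.+1 < d - m)%N by lia.
by have := H _ kd'; rewrite -addnA -mulnDl subnKC // -ik eqxx.
Qed.

Lemma res_poly_ends : [/\ size R = d.+1, R`_0 != 0 & R != 0].
Proof.
have [[h0 e0 cop d0] ss sE kE _] := side.
have c0 i : i \in supp -> (e * u i + h * i = k0)%N -> side_coef i != 0.
  move=> si ik; rewrite /side_coef si ik eqxx /=.
  apply: unit_part_red => //; first by rewrite -mem_dev_supp.
  exact: size_dev.
have R0 : R`_0 != 0 by rewrite -side_coefE // mul0n addn0 c0.
have Rd : R`_d != 0 by rewrite -side_coefE // c0.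
split=> //; last by apply: contraNneq R0 => ->; rewrite coef0.
apply/eqP; rewrite eqn_leq size_res_poly_le /= ltnNge; apply: contra Rd.
by move/(nth_default 0) => ->.
Qed.

End SideInitial.

(** * Maximality at one factor *)

Lemma extremal_index (I : pred nat) (w : nat -> rat) n :
    (forall j, I j -> (j <= n)%N) -> (exists j, I j) ->
  exists j0, [/\ I j0, forall j, I j -> w j0 <= w j
                 & forall j, I j -> w j = w j0 -> (j <= j0)%N].
Proof.
move=> I_n [j1 Ij1]; pose gs := [seq j <- iota 0 n.+1 | I j].
have gsP j : (j \in gs) = I j.
  rewrite mem_filter mem_iota /= add0n ltnS andb_idr //; exact: I_n.
pose m := seqmin 0 (map w gs).
have m_le j : I j -> m <= w j.
  by rewrite -gsP => jg; apply: seqmin_le; apply: map_f.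
have : m \in map w gs.
  apply: seqmin_mem; rewrite -size_eq0 size_map size_eq0.
  by move: Ij1; rewrite -gsP; apply: contraTneq => ->.
case/mapP=> j2; rewrite gsP => Ij2 wj2.
have ex : exists j, I j && (w j == m) by exists j2; rewrite Ij2 -wj2 eqxx.
have bd j : I j && (w j == m) -> (j <= n)%N by case/andP=> /I_n.
have [j0 /andP[Ij0 /eqP wj0] j0_max] := ex_maxnP ex bd.
exists j0; rewrite wj0; split=> // j Ij wj.
by apply: j0_max; rewrite Ij wj eqxx.
Qed.

Lemma integral_remainder (e h j k : nat) (y : rat) : (0 < e)%N -> 0 <= y ->
    e%:R * y + h%:R * j%:R = k%:R ->
  exists r, [/\ (e * Num.truncn y + r + h * j)%N = k, (r < e)%N
              & r%:R = e%:R * (y - (Num.truncn y)%:R)].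
Proof.
move=> e0 y0 yk; have /andP[n_le lt_n] := truncn_itv y0.
have e0R : (0 : rat) < e%:R by rewrite ltr0n.
move: (Num.truncn y) n_le lt_n => n n_le lt_n.
have le_k : (e * n + h * j <= k)%N.
  by rewrite -(ler_nat rat) -yk natrD !natrM lerD2r ler_pM2l.
have lt_k : (k < e * n + h * j + e)%N.
  rewrite -(ltr_nat rat) -yk !natrD !natrM.
  by move: lt_n; rewrite -natr1 -(ltr_pM2l e0R) mulrDr mulr1; lra.
have rE : (e * n + (k - (e * n + h * j)) + h * j)%N = k by lia.
exists (k - (e * n + h * j))%N; split=> //; first by lia.
move: (k - _)%N rE => r rE; move: yk; rewrite -rE !natrD !natrM; lra.
Qed.

(** Subtracting, e divides h (j - i), and h is coprime to e. *)
Lemma congr_abscissa (e h s i j ni nj : nat) : coprime h e -> (s < i)%N -> (s < j)%N ->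
    (e * ni + h * i = e * nj + h * j)%N ->
  (i - s.+1 = j - s.+1 %[mod e])%N.
Proof.
move=> cop; wlog ij : i j ni nj / (i <= j)%N => [H si sj E|si sj E].
  have [ij|/ltnW ji] := leqP i j; first exact: H E.
  by apply/esym; apply: H (esym E).
apply/esym/eqP; rewrite eqn_mod_dvd; last by lia.
have -> : (j - s.+1 - (i - s.+1) = j - i)%N by lia.
have : (e %| h * (j - i))%N.
  have -> : (h * (j - i) = e * (ni - nj))%N by rewrite !mulnBr; lia.
  exact: dvdn_mulr.
by rewrite mulnC Gauss_dvdl // coprime_sym.
Qed.

Section Maximality.

Variables (p : nat) (K : fieldExtType rat) (theta : K).
Variables (phi f : {poly int}) (ell : nat) (Psi : {poly 'F_p}).
Hypothesis p_prime : prime p.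
Hypothesis f_monic : f \is monic.
Hypothesis f_irr : irreducible_poly f.
Hypothesis theta_root : root (map_poly intr f) theta.
Hypothesis phi_monic : phi \is monic.
Hypothesis phi_irr : monic_irreducible_poly (redp p phi).
Hypothesis f_fact : redp p f = redp p phi ^+ ell * Psi.
Hypothesis Psi_ndvd : ~~ (redp p phi %| Psi).
Hypothesis f_reg : phi_regular f phi_irr.

Local Notation F := {poly %/ redp p phi with phi_irr}.
Local Notation red := (red phi_irr).
Local Notation ev := (eval_at theta).
Local Notation q j := (rdivp f (phi ^+ j)).
Local Notation a j := (dev phi f j).
Local Notation u i := (vp p (dev phi f i)).
Local Notation supp := (dev_supp phi f).
Local Notation Y := (np_ord p phi f).
Local Notation n j := (Num.truncn (np_ord p phi f j)).

Let size_phi : (1 < size phi)%N := size_phi_gt1 phi_monic phi_irr.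

Variables (Phi : {poly int}) (c : nat -> {poly int}).
Hypothesis Phi_red : red Phi != 0.
Hypothesis size_c : forall j, (size (c j) < size phi)%N.

Local Notation x :=
  (\sum_(1 <= j < ell.+1) ev Phi * ev (c j) * ev (q j) / p%:R ^+ (n j).+1).
Hypothesis x_int : OKloc p x.

Let pK0 : (p%:R : K) != 0 := pK_neq0 K p_prime.

Lemma clear_denominators nu (g : nat -> {poly int}) (y : K) :
  (forall j, (0 < j <= ell)%N -> (n j <= nu)%N) ->
  (forall j, (0 < j <= ell)%N -> y * ev (q j) = ev (g j)) ->
  p%:R ^+ nu.+1 * y * x
    = ev (Phi * \sum_(1 <= j < ell.+1) c j * p%:R ^+ (nu - n j) * g j).
Proof.
move=> n_le yg; rewrite [RHS]rmorphM /= rmorph_sum !mulr_sumr !big_nat.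
apply: eq_bigr => j; rewrite ltnS => jl.
rewrite !rmorphM rmorphXn rmorph_nat /= -yg //.
rewrite -[in LHS](subnK (n_le j jl)) -addnS exprD.
have : (p%:R ^+ (n j).+1 : K) != 0 by rewrite expf_neq0.
move: (_ ^+ (n j).+1) (_ ^+ (nu - n j)) (ev _) (ev _) (ev _) => y1 y2 y3 y4 y5 y10.
by field.
Qed.

(** Here f = phi has initial form X for e = h = 1, and X does not divide a nonzero
constant. *)
Lemma coefs_red_eq0_degenerate : a 0 = 0 -> forall j, (0 < j <= ell)%N -> red (c j) = 0.
Proof.
move=> a0 j; have ell1 := degenerate_ell p_prime f_monic f_irr phi_monic phi_irr f_fact Psi_ndvd a0.
rewrite ell1 => jl; have -> : j = 1%N by lia.
have Ephi := degenerate_phi f_monic f_irr phi_monic phi_irr a0.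
have n1 : n 1 = 0%N.
  by rewrite (degenerate_np p_prime f_monic f_irr phi_monic phi_irr a0) truncn0.
have q1 : q 1 = 1 by rewrite expr1 Ephi rdivpp // (monicP f_monic) expr1n.
have [S [sigma [pi [rho M]]]] := ramified_model_exists p_prime phi_monic phi_irr (ltn0Sn 0) (ltn0Sn 0).
have E : p%:R ^+ 1 * x = ev (Phi * c 1%N).
  rewrite ell1 big_nat1 n1 q1 rmorph1 mulr1 mulrC mulfVK //.
  by rewrite rmorphM.
have E2 : p%:R ^+ 0.+1 * ev phi ^+ 0 * x = ev (Phi * c 1%N) by rewrite expr0 mulr1.
have L : initial sigma pi rho (1 * 0 + 1 * 0 + 0) (Phi * c 1%N) (red (Phi * c 1%N))%:P.
  exact: (initial_const M).
have Lf : initial sigma pi rho 1 f 'X by rewrite -Ephi; apply: initial_phi M.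
have [N] := integral_initial_form p_prime f_monic f_irr theta_root M x_int E E2 L (ltn0Sn 0) Lf (monic_neq0 (monicX _)).
case: (eqVneq (red (Phi * c 1%N)) 0) => [E0 _|nz].
  by move/eqP: E0; rewrite rmorphM mulf_eq0 (negPf Phi_red) => /eqP.
rewrite -polyC_exp => /dvdp_leq; rewrite polyC_eq0 size_polyX size_polyC.
by rewrite !expf_neq0 // => /(_ isT).
Qed.

Section OneSide.

Variables (h e s d j0 kap : nat).
Hypothesis s0 : 0%N \in supp.
Hypothesis side : np_side p phi f h e s d.
Hypothesis s'l : (s + d * e <= ell)%N.
Hypothesis j0_side : (s < j0 <= s + d * e)%N.
Local Notation k0 := (e * u s + h * s)%N.
(* The fraction kap / e is the fractional part of the ordinate at j0. *)
Hypothesis Ekap : (e * n j0 + kap + h * j0 = k0)%N.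
Hypothesis kap_e : (kap < e)%N.
(* Among the j with c j nonzero modulo (p, phi), the fractional part of the
   ordinate is least at j0, and j0 is the last such index. *)
Hypothesis kap_min : forall j, (0 < j <= ell)%N -> red (c j) != 0 ->
  (e * n j + kap)%:R <= e%:R * Y j.
Hypothesis j0_max : forall j, (0 < j <= ell)%N -> red (c j) != 0 ->
  (e * n j + kap)%:R = e%:R * Y j -> (j <= j0)%N.

Let sl := dev_supp_ell phi_monic size_phi phi_irr f_fact Psi_ndvd.
Let ul := vp_dev_ell phi_monic size_phi p_prime phi_irr f_fact Psi_ndvd.
Let u0 := vp_dev_lt phi_monic size_phi p_prime phi_irr f_fact.

Variables (S : comNzRingType) (sigma : {rmorphism {poly int} -> S}) (pi : S)
    (rho : {rmorphism S -> {poly F}}).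
Hypothesis M : ramified_model e h sigma pi rho.
Local Notation initial := (initial sigma pi rho).
Local Notation qr j := (quot_repr phi f ell s j).
Local Notation nu := (n 0).

(** The abscissas beyond s where the line of the side has ordinate n j + kap / e:
the only ones that contribute to the initial form of the numerator. *)
Definition on_level j := (s < j)%N && (e * n j + kap + h * j == k0)%N.

Definition initial_summand j : {poly F} :=
  if on_level j then
    (red (c j))%:P * \sum_(j <= i < size f) (side_coef f phi_irr e h s i)%:P * 'X^(i - j + ell)
  else 0.

Lemma np_ge_trunc j : (j <= ell)%N -> (n j)%:R <= Y j.
Proof. by move=> jl; rewrite truncn_le (np_ge0 s0 sl). Qed.

Lemma trunc_le0 j : (0 < j <= ell)%N -> (n j <= nu)%N.
Proof. by move=> jl; apply/le_truncn/ltW; apply: (np_decr s0 sl ul u0). Qed.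

(** Off the level the value exceeds the bound: if c_j vanishes modulo (p, phi) it
contributes a factor p, and kap < e; if the fractional part of y_j is larger than
kap / e, this is clear; if it is equal then j <= j0, so j is left of the side and
[quot_repr_lt] is strict. *)
Lemma initial_quot_summand j : (0 < j <= ell)%N ->
  initial (h * ell + (e * n j + kap)) (c j * qr j) (initial_summand j).
Proof.
move=> jl; have jl' : (j <= ell)%N by case/andP: jl.
have e0R : (0 : rat) < e%:R by rewrite ltr0n (side_e_gt0 side).
have Lc := initial_const M (c j).
rewrite /initial_summand; case: ifP => [/andP[sj /eqP cj]|ncond].
  have := initialM Lc (quot_repr_eq ell p_prime phi_monic M side sj cj).
  by rewrite add0n.
have [cj0|cjn] := eqVneq (red (c j)) 0.
  have [b Eb] : exists b, c j = p%:R * b.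
    apply/(redp_eq0 p_prime)/(redp_small_eq0 phi_monic (size_c j)).
    by move/eqP: cj0; rewrite (in_qfpoly_eq0 phi_irr).
  have [|T LT] := quot_repr_le p_prime phi_monic M side f_fact Psi_ndvd s'l s0 jl
                    (w := (e * n j)%N).
    by rewrite natrM ler_pM2l // np_ge_trunc.
  have := initialM (initialM (initial_p M) (initial_const M b)) LT; rewrite -Eb; apply: (initial_lt M).
  by move: (e * n j)%N (h * ell)%N kap_e => x1 x2; clear; lia.
suff L0 : initial (h * ell + (e * n j + kap)) (qr j) 0.
  by have := initialM Lc L0; rewrite mulr0.
apply: (quot_repr_lt p_prime phi_monic M side f_fact Psi_ndvd s'l s0 jl).
  exact: kap_min.
apply/implyP => sj; rewrite lt_neqAle kap_min // andbT; apply/eqP => Ew.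
have jj0 := j0_max jl cjn Ew.
have Yj : e%:R * Y j + h%:R * j%:R = k0%:R.
  apply: (side_np_eq s0 sl ul side) => //.
  by rewrite (ltnW sj) (leq_trans jj0) //; case/andP: j0_side.
move: ncond; rewrite /on_level sj /= -(eqr_nat rat) natrD Ew natrM Yj.
by rewrite eqxx.
Qed.

Lemma initial_numerator :
  initial (h * ell + e * nu + kap)
    (Phi * \sum_(1 <= j < ell.+1) c j * p%:R ^+ (nu - n j) * qr j)
    ((red Phi)%:P * \sum_(1 <= j < ell.+1) initial_summand j).
Proof.
rewrite -[X in initial X _ _]add0n; apply: initialM (initial_const M Phi) _.
rewrite big_nat [X in initial _ _ X]big_nat; apply: initial_sum => j.
rewrite ltnS => jl.
have := initialM (initialX M (nu - n j) (initial_p M)) (initial_quot_summand jl).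
rewrite expr1n mul1r mulrCA mulrA.
suff -> : (e * (nu - n j) + (h * ell + (e * n j + kap)) = h * ell + e * nu + kap)%N by [].
rewrite -{2}(subnK (trunc_le0 jl)) mulnDr; move: (e * (_ - _))%N (e * n j)%N (h * ell)%N => x1 x2 x3.
by clear; lia.
Qed.

Local Notation r := ((j0 - s.+1) %% e)%N.
Local Notation m0 := ((j0 - s.+1) %/ e)%N.
Local Notation jm m := (s.+1 + r + m * e)%N.
Local Notation R := (res_poly f phi_irr e s d).

Definition level_coef m : F := if on_level (jm m) then red (c (jm m)) else 0.

Lemma extremal_abscissaE : j0 = jm m0.
Proof.
rewrite -addnA [(r + _)%N]addnC -divn_eq subnKC //; by case/andP: j0_side.
Qed.

Lemma remainder_lt : (r < e)%N. Proof. by rewrite ltn_mod (side_e_gt0 side). Qed.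

Lemma step_lt i : (s < i <= s + d * e)%N -> ((i - s.+1) %/ e < d)%N.
Proof. by move=> si; rewrite ltn_divLR ?(side_e_gt0 side) //; clear -si; lia. Qed.

Lemma abscissa_le m : (m < d)%N -> (jm m <= s + d * e)%N.
Proof.
move=> md; have : (m.+1 * e <= d * e)%N by rewrite leq_mul2r md orbT.
by have := remainder_lt; rewrite mulSn; move: (m * e)%N (d * e)%N r => x1 x2 x3; clear; lia.
Qed.

(** The abscissas on the level form an arithmetic progression of step e, the step at
which the ordinates of the side change by an integer. *)
Lemma sum_initial_summand :
  \sum_(1 <= j < ell.+1) initial_summand j
    = 'X^(ell + (e.-1 - r)) *
      ((\sum_(m < d) level_coef m *: drop_poly m.+1 R) \Po 'X^e).
Proof.
have -> : \sum_(1 <= j < ell.+1) initial_summand j = \sum_(j < ell.+1) initial_summand j.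
  by rewrite -(big_mkord xpredT) [RHS]big_ltn // {2}/initial_summand /on_level ltn0 add0r.
rewrite (@sum_arith_prog _ initial_summand _ (s.+1 + r) e d) ?(side_e_gt0 side) //.
- rewrite rmorph_sum /= mulr_sumr; apply: eq_bigr => m _.
  rewrite /initial_summand /level_coef linearZ /=; case: ifP => _; last by rewrite scale0r mulr0.
  rewrite (side_poly_q p_prime phi_monic phi_irr side f_fact Psi_ndvd s'l s0 remainder_lt (ltn_ord m)).
  by rewrite mul_polyC scalerAr.
- by move=> m md; rewrite ltnS (leq_trans (abscissa_le md)).
move=> i il H; rewrite /initial_summand; case: ifP => // /andP[si /eqP ci].
have [is'|s'i] := leqP i (s + d * e); last first.
  by rewrite (side_poly_q0 ell p_prime phi_monic phi_irr side) // mulr0.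
have cop : coprime h e by case: side => -[].
have sj0 : (s < j0)%N by case/andP: j0_side.
have E : (e * n i + h * i = e * n j0 + h * j0)%N.
  by move: ci; rewrite -Ekap; move: (e * _)%N (e * _)%N (h * _)%N (h * _)%N => x1 x2 x3 x4; clear; lia.
have mod_eq := congr_abscissa cop si sj0 E.
have md : ((i - s.+1) %/ e < d)%N by apply: step_lt; rewrite si.
have := H _ md; rewrite -mod_eq -addnA [((_ %% _) + _)%N]addnC -divn_eq subnKC //.
by rewrite eqxx.
Qed.

(** The coefficient of index j0 in the combination of truncations is nonzero. *)
Lemma initial_numerator_ndvd N :
    red (c j0) != 0 ->
  ~~ ('X^s * (R \Po 'X^e) %|
      ((red Phi)%:P * \sum_(1 <= j < ell.+1) initial_summand j) ^+ N).
Proof.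
move=> cj0; rewrite sum_initial_summand.
have [szR R0 Rn0] := res_poly_ends p_prime phi_monic phi_irr side f_fact Psi_ndvd s'l s0.
apply: ndvd_exp_initial => //.
- exact: side_e_gt0 side.
- exact: f_reg side.
- apply: drop_comb_neq0 szR _; exists m0; first exact: step_lt.
  rewrite /level_coef -extremal_abscissaE /on_level Ekap eqxx andbT.
  by case/andP: j0_side => -> _.
by rewrite szR ltnS; apply: size_drop_comb.
Qed.

End OneSide.

(** Otherwise take the index j0 with least fractional part of y_j, then largest, and
the side above it: [integral_initial_form] contradicts
[initial_numerator_ndvd]. *)
Lemma coefs_red_eq0_side : 0%N \in supp -> forall j, (0 < j <= ell)%N -> red (c j) = 0.
Proof.
move=> s0 j1 j1l; apply/eqP; apply: contraT => cj1.
have sl := dev_supp_ell phi_monic size_phi phi_irr f_fact Psi_ndvd.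
have ul := vp_dev_ell phi_monic size_phi p_prime phi_irr f_fact Psi_ndvd.
have u0 := vp_dev_lt phi_monic size_phi p_prime phi_irr f_fact.
pose I j := (0 < j <= ell)%N && (red (c j) != 0).
have I_ell j : I j -> (j <= ell)%N by case/andP=> /andP[].
have [|j0 [/andP[j0l cj0] j0_min j0_max]] := extremal_index (fun j => Y j - (n j)%:R) I_ell.
  by exists j1; rewrite /I j1l cj1.
have [h [e [s [d [side j0s s'l]]]]] := side_exists s0 sl ul u0 j0l.
have e0 := side_e_gt0 side.
have h0 : (0 < h)%N by case: side => -[].
have e0R : (0 : rat) < e%:R by rewrite ltr0n.
have j0l' : (j0 <= ell)%N by case/andP: j0l.
have Yj0 : e%:R * Y j0 + h%:R * j0%:R = (e * u s + h * s)%:R.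
  by apply: (side_np_eq s0 sl ul side) => //; case/andP: j0s => /ltnW -> ->.
have [kap [Ekap kap_e kapE]] := integral_remainder e0 (np_ge0 s0 sl ul j0l') Yj0.
have kap_min j : (0 < j <= ell)%N -> red (c j) != 0 -> (e * n j + kap)%:R <= e%:R * Y j.
  move=> jl cj; rewrite natrD natrM kapE -mulrDr ler_pM2l //.
  by rewrite addrC -lerBrDr; apply: j0_min; rewrite /I jl.
have kap_max j : (0 < j <= ell)%N -> red (c j) != 0 ->
    (e * n j + kap)%:R = e%:R * Y j -> (j <= j0)%N.
  move=> jl cj; rewrite natrD natrM kapE -mulrDr => /(mulfI (lt0r_neq0 e0R)) E.
  by apply: j0_max; [rewrite /I jl | move: E; rewrite /=; lra].
have [S [sigma [pi [rho M]]]] := ramified_model_exists p_prime phi_monic phi_irr e0 h0.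
have n_nu j : (0 < j <= ell)%N -> (n j <= n 0)%N by apply: trunc_le0.
have E1 : p%:R ^+ (n 0).+1 * x = ev (Phi * \sum_(1 <= j < ell.+1) c j * p%:R ^+ (n 0 - n j) * q j).
  rewrite -[X in X * _]mulr1; apply: clear_denominators => // j _; exact: mul1r.
have E2 : p%:R ^+ (n 0).+1 * ev phi ^+ ell * x
    = ev (Phi * \sum_(1 <= j < ell.+1) c j * p%:R ^+ (n 0 - n j) * quot_repr phi f ell s j).
  apply: clear_denominators => // j /andP[_ jl].
  have [b Eb] := quot_reprE f phi_monic phi_irr s jl.
  have := congr1 ev Eb; rewrite !rmorphM rmorphD rmorphXn rmorphM /= (ev_f theta_root).
  by rewrite mul0r addr0.
have LG := initial_numerator s0 side s'l j0s kap_e kap_min kap_max M.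
have Lf := initial_f_side p_prime phi_monic M side.
rewrite (side_poly_f p_prime phi_monic phi_irr side f_fact Psi_ndvd s'l s0) in Lf.
have [szR R0 Rn0] := res_poly_ends p_prime phi_monic phi_irr side f_fact Psi_ndvd s'l s0.
have Pf0 : 'X^s * (res_poly f phi_irr e s d \Po 'X^e) != 0.
  apply: mulf_neq0; first by rewrite monic_neq0 ?monicXn.
  by rewrite -size_poly_eq0 size_comp_Xn.
have [N] := integral_initial_form p_prime f_monic f_irr theta_root M x_int E1 E2 LG kap_e Lf Pf0.
by rewrite (negPf (initial_numerator_ndvd s0 side s'l j0s Ekap N cj0)).
Qed.

Lemma coefs_red_eq0 j : (0 < j <= ell)%N -> red (c j) = 0.
Proof.
have [a0|a0] := eqVneq (a 0) 0; first exact: coefs_red_eq0_degenerate.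
by apply: coefs_red_eq0_side; rewrite mem_dev_supp.
Qed.

End Maximality.

(** * Bases from saturation *)

Section Descent.

Variables (p : nat) (K : fieldExtType rat).
Hypothesis p_prime : prime p.
Variables (I : finType) (b : I -> K).
Hypothesis b_sat : forall C : I -> int,
  OKloc p ((\sum_i (C i)%:~R * b i) / p%:R) -> forall i, (p %| C i)%Z.
Hypothesis dim_le : (\dim {:K} <= #|I|)%N.

Let pK0 : (p%:R : K) != 0 := pK_neq0 K p_prime.

Lemma OKloc_nat n : OKloc p (n%:R : K).
Proof. by apply: OKloc_int => //; apply: integral_nat. Qed.

Lemma divide_coefs (C : I -> int) : (forall i, (p %| C i)%Z) ->
  exists2 C' : I -> int, forall i, C i = C' i * p%:Z
    & \sum_i (C i)%:~R * b i = p%:R * \sum_i (C' i)%:~R * b i.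
Proof.
move=> pC; exists (fun i => (C i %/ p)%Z) => [i|]; first by rewrite divzK.
rewrite mulr_sumr; apply: eq_bigr => i _.
by rewrite -{1}(divzK (pC i)) intrM -pmulrn; ring.
Qed.

(** Saturation removes one factor p at a time. *)
Lemma saturated_exp n (C : I -> int) :
  OKloc p ((\sum_i (C i)%:~R * b i) / p%:R ^+ n) -> forall i, ((p ^ n)%:Z %| C i)%Z.
Proof.
elim: n C => [|n IH] C OKC i; first by rewrite expn0 dvd1z.
have pC : forall i, (p %| C i)%Z.
  apply: b_sat; have := OKlocM p_prime (OKloc_nat (p ^ n)) OKC.
  suff -> : (p ^ n)%:R * ((\sum_i (C i)%:~R * b i) / p%:R ^+ n.+1)
     = (\sum_i (C i)%:~R * b i) / p%:R :> K by [].
  by rewrite natrX mulrCA exprSr invfM mulVKf // expf_neq0.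
have [C' CE sumE] := divide_coefs pC.
rewrite CE expnSr PoszM dvdz_mul // IH //.
move: OKC; rewrite sumE exprS invfM mulrACA divff // mul1r.
by [].
Qed.

(** A relation is p^n times a p-integral element for every n, so every power of p
divides its coefficients. *)
Lemma int_combination_eq0 (C : I -> int) :
  \sum_i (C i)%:~R * b i = 0 -> forall i, C i = 0.
Proof.
move=> C0 i; apply/eqP; apply: contraT => Ci.
have := @saturated_exp `|C i|%N C; rewrite C0 mul0r => /(_ (OKloc_nat 0) i).
rewrite dvdzE absz_nat => /dvdn_leq; rewrite absz_gt0 => /(_ Ci).
by rewrite leqNgt ltn_expl // prime_gt1.
Qed.

Lemma common_denominator (r : I -> rat) :
  exists n (C : I -> int), (0 < n)%N /\ forall i, r i = (C i)%:~R / n%:R.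
Proof.
exists (\prod_i `|denq (r i)|)%N,
  (fun i => numq (r i) * (\prod_(j | j != i) `|denq (r j)|)%N%:Z); split.
  by rewrite prodn_gt0 // => i; rewrite absz_gt0 denq_neq0.
move=> i; have -> : (\prod_j `|denq (r j)| = `|denq (r i)| * \prod_(j | j != i) `|denq (r j)|)%N.
  by rewrite (bigD1 i).
rewrite intrM natrM -!pmulrn; set m := (\prod_(j | j != i) _)%N.
have m0 : (m%:R : rat) != 0.
  by rewrite pnatr_eq0 -lt0n prodn_cond_gt0 // => j _; rewrite absz_gt0 denq_neq0.
rewrite invfM mulrACA divff // mulr1 -{1}[r i]divq_num_den; congr (_ / _).
by rewrite pmulrn absz_denq.
Qed.

Lemma scale_combination (r : I -> rat) n (C : I -> int) : (0 < n)%N ->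
  (forall i, r i = (C i)%:~R / n%:R) ->
  n%:R * \sum_i r i *: b i = \sum_i (C i)%:~R * b i.
Proof.
move=> n0 rE; rewrite mulr_sumr; apply: eq_bigr => i _.
have n0Q : (n%:R : rat) != 0 by rewrite pnatr_eq0 -lt0n.
rewrite -[(C i)%:~R](rmorph_int (in_alg K)) /= rE mulr_natl -scaler_nat scalerA mulrCA divff // mulr1.
by rewrite mulr_algl.
Qed.

Lemma combination_eq0 (r : I -> rat) : \sum_i r i *: b i = 0 -> forall i, r i = 0.
Proof.
have [n [C [n0 rE]]] := common_denominator r.
move=> r0 i; have := scale_combination n0 rE; rewrite r0 mulr0 => /esym C0.
by rewrite rE (int_combination_eq0 C0) mul0r.
Qed.

Lemma combination_exists (x : K) : exists r : I -> rat, x = \sum_i r i *: b i.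
Proof.
pose X := [tuple b (enum_val i) | i < #|I|].
have Xi (i : 'I_#|I|) : X`_i = b (enum_val i).
  by rewrite (nth_map i) ?size_enum_ord // nth_ord_enum.
have freeX : free X.
  apply/freeP => k k0 i; pose r j := k (enum_rank j).
  rewrite -[i]enum_valK; apply: (@combination_eq0 r).
  rewrite -[RHS]k0 [RHS](reindex _ (onW_bij _ (@enum_rank_bij I))) /=.
  by apply: eq_bigr => j _; rewrite Xi enum_rankK.
have basX : basis_of fullv X by rewrite basisEfree freeX subvf size_tuple.
exists (fun i => coord X (enum_rank i) x).
rewrite {1}(coord_basis basX (memvf x)) (reindex _ (onW_bij _ (@enum_rank_bij I))) /=.
by apply: eq_bigr => j _; rewrite Xi enum_rankK.
Qed.

(** Write the coordinates of x with a common denominator m p^k, p not dividing m.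
As m x is p-integral, p^k divides the numerators, so that the coordinates have
denominators dividing m. *)
Lemma p_integral_basis_of_saturated :
  (forall i, OKloc p (b i)) -> p_integral_basis p b.
Proof.
move=> b_int; split=> // [x OKx|c _ c0]; last exact: combination_eq0.
have [r xE] := combination_exists x.
have [n [C [n0 rE]]] := common_denominator r.
have [m pm nE] := pfactor_coprime p_prime n0.
set k := logn p n in nE.
have m0 : (m%:R : rat) != 0.
  by rewrite pnatr_eq0; apply: contraTneq n0 => m0; rewrite nE m0 mul0n.
have pCk : forall i, ((p ^ k)%:Z %| C i)%Z.
  apply: saturated_exp; rewrite -(scale_combination n0 rE) -xE nE natrM natrX.
  rewrite mulrAC mulfK ?expf_neq0 //.
  exact: (OKlocM p_prime (OKloc_nat m) OKx).
have pQ0 : (p%:R ^+ k : rat) != 0 by rewrite expf_neq0 // pnatr_eq0 -lt0n prime_gt0.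
exists r => // i; rewrite /Zloc inE.
have rmE : r i * m%:R = (C i %/ (p ^ k)%:Z)%Z%:~R.
  rewrite rE nE natrM natrX -{1}(divzK (pCk i)) intrM -pmulrn natrX.
  by rewrite invfM mulrA mulrAC mulfVK // mulfK.
apply/negP => p_den.
suff : (p %| m)%N by apply/negP; rewrite -prime_coprime.
apply: dvdn_trans p_den _.
have : (denq (r i) %| numq (r i) * m%:Z)%Z.
  apply/dvdzP; exists (C i %/ (p ^ k)%:Z)%Z; apply: (@intr_inj rat).
  rewrite !intrM -rmE -pmulrn -{2}[r i]divq_num_den; field.
  by rewrite intr_eq0 denq_neq0.
by rewrite dvdzE abszM Gauss_dvdr // coprime_sym coprime_num_den.
Qed.

End Descent.

(** * Assembly *)

Lemma irreducible_ndvd_prod (F : fieldType) (I : finType) (P : pred I)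
    (g : {poly F}) (G : I -> {poly F}) (l : I -> nat) :
  monic_irreducible_poly g -> (forall i, P i -> monic_irreducible_poly (G i) /\ g != G i) ->
  ~~ (g %| \prod_(i | P i) G i ^+ l i).
Proof.
move=> [g_irr g_mon] GP.
have cop : coprimep g (\prod_(i | P i) G i ^+ l i).
  elim/big_ind: _ => [|x y gx gy|i Pi]; first exact: coprimep1.
    by rewrite coprimepMr gx.
  apply: coprimep_expr; rewrite irreducible_poly_coprime //.
  have [[[_ Gi_irr] Gi_mon] neq] := GP i Pi.
  apply: contra neq => /Gi_irr; rewrite gtn_eqF; last exact: g_irr.1.
  by move/(_ isT); rewrite eqp_monic.
apply/negP => dv; have := coprimep_dvdl dv cop.
by rewrite coprimepp gtn_eqF //; apply: g_irr.1.
Qed.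

Lemma size_prod_exp (F : fieldType) (I : finType) (G : I -> {poly F}) (l : I -> nat) :
  (forall i, G i != 0) ->
  (size (\prod_i G i ^+ l i)).-1 = (\sum_i l i * (size (G i)).-1)%N.
Proof.
move=> G0.
suff: \prod_i G i ^+ l i != 0 /\
      (size (\prod_i G i ^+ l i)).-1 = (\sum_i l i * (size (G i)).-1)%N by case.
apply: (big_ind2 (fun (P : {poly F}) n => P != 0 /\ (size P).-1 = n)).
- by rewrite oner_eq0 size_poly1.
- move=> P m Q n [P0 <-] [Q0 <-]; rewrite mulf_neq0 // size_mul //.
  have := size_poly_gt0 P; have := size_poly_gt0 Q; rewrite P0 Q0.
  by case: (size P) => // a; case: (size Q) => // b _ _; rewrite addnS.
by move=> i _; rewrite expf_neq0 // size_exp mulnC.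
Qed.

Section Assembly.

Variables (p : nat) (f : {poly int}) (K : fieldExtType rat) (theta : K)
  (t : nat) (phi : 'I_t -> {poly int}) (ell : 'I_t -> nat).
Hypothesis p_prime : prime p.
Hypothesis f_monic : f \is monic.
Hypothesis f_irr : irreducible_poly f.
Hypothesis theta_root : root (map_poly intr f) theta.
Hypothesis K_gen : <<1; theta>>%VS = fullv.
Hypothesis phi_monic : forall i, phi i \is monic.
Hypothesis phi_irr : forall i, monic_irreducible_poly (redp p (phi i)).
Hypothesis phi_inj : injective (fun i => redp p (phi i)).
Hypothesis f_fact : redp p f = \prod_(i < t) redp p (phi i) ^+ ell i.
Hypothesis f_reg : p_regular f phi_irr.

Local Notation ev := (eval_at theta).
Local Notation Idx := {i : 'I_t & ('I_(ell i) * 'I_(size (phi i)).-1)%type}.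
Local Notation n i j := (Num.truncn (np_ord p (phi i) f j)).
Local Notation q i j := (rdivp f (phi i ^+ j)).

Definition index_basis (x : Idx) : K :=
  let: existT i (j, k) := x in basis_elt p f (phi i) theta j.+1 k.

Let pK0 : (p%:R : K) != 0 := pK_neq0 K p_prime.
Let size_phi i : (1 < size (phi i))%N := size_phi_gt1 (phi_monic i) (phi_irr i).

Definition cofactor_mod i : {poly 'F_p} := \prod_(i' | i' != i) redp p (phi i') ^+ ell i'.

Lemma f_fact_at i : redp p f = redp p (phi i) ^+ ell i * cofactor_mod i.
Proof. by rewrite f_fact (bigD1 i). Qed.

Lemma cofactor_ndvd i : ~~ (redp p (phi i) %| cofactor_mod i).
Proof.
apply: irreducible_ndvd_prod => // i' ne; split=> //.
by apply: contra ne => /eqP/phi_inj->.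
Qed.

Let data i := polygon_data p_prime f_monic f_irr (phi_monic i) (phi_irr i)
                (f_fact_at i) (cofactor_ndvd i).

Lemma basis_eltE i j k : (0 < j <= ell i)%N ->
  basis_elt p f (phi i) theta j k = ev (q i j) * theta ^+ k / p%:R ^+ n i j.
Proof.
move=> jl; have [v [v0 _ _ vY _]] := data i.
have Y0 : 0 <= np_ord p (phi i) f j by rewrite vY.
rewrite /basis_elt; suff -> : Num.floor (np_ord p (phi i) f j) = n i j :> int by [].
by rewrite truncn_floor Y0 gez0_abs // floor_ge0.
Qed.

Lemma index_basis_int x : OKloc p (index_basis x).
Proof.
case: x => i [j k] /=; have jl : (0 < j.+1 <= ell i)%N by rewrite ltn_ord.
rewrite basis_eltE //; have [v [v0 v_le v_cv vY _]] := data i.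
rewrite mulrAC; apply: OKlocM => //; last first.
  by have := OKloc_ev p_prime f_monic theta_root 'X^k; rewrite rmorphXn /= /ev map_polyX hornerX.
apply: OKloc_int => //; rewrite vY //.
exact: (quot_elt_integral p_prime f_monic theta_root (phi_monic i) (size_phi i) v0 v_le v_cv).
Qed.

(** The number of elements is the degree of f modulo p, hence deg f. *)
Lemma dim_le_card : (\dim {:K} <= #|{: Idx}|)%N.
Proof.
have -> : #|{: Idx}| = (size f).-1.
  rewrite -(size_redp_monic p f_monic) f_fact size_prod_exp; last first.
    by move=> i; rewrite monic_neq0 //; case: (phi_irr i).
  rewrite card_tagged sumnE big_map big_enum /=; apply: eq_bigr => i _.
  by rewrite card_prod !card_ord size_redp_monic.
rewrite -K_gen dim_Fadjoin dimv1 muln1 -ltnS -size_minPoly prednK ?size_poly_gt0 ?monic_neq0 //.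
have sz : size (map_poly (intr : int -> K) f) = size f.
  by rewrite size_map_poly_id0 // (monicP f_monic) oner_eq0.
rewrite -sz dvdp_leq //; first by rewrite monic_neq0 // monic_map.
apply: minPoly_dvdp theta_root.
by apply/polyOverP => i; rewrite coef_map rpred_int.
Qed.

Section Saturation.

Variable C : Idx -> int.
Hypothesis C_int : OKloc p ((\sum_x (C x)%:~R * index_basis x) / p%:R).

(** Collects the coefficients of q_(i,j) theta^k for all k into one polynomial; j is
counted from 1, and values of j out of range give 0. *)
Definition coef_poly_at i j : {poly int} :=
  \poly_(k < (size (phi i)).-1)
    oapp (fun j' : 'I_(ell i) =>
      oapp (fun k' : 'I_(size (phi i)).-1 => C (existT _ i (j', k'))) 0 (insub k)) 0 (insub j.-1).

Local Notation c i j := (coef_poly_at i j).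

Lemma coef_poly_atE i (j : 'I_(ell i)) (k : 'I_(size (phi i)).-1) :
  (c i j.+1)`_k = C (existT _ i (j, k)).
Proof. by rewrite coef_poly ltn_ord /= !valK. Qed.

Lemma size_coef_poly_at i j : (size (c i j) < size (phi i))%N.
Proof.
apply: leq_ltn_trans (size_poly _ _) _; rewrite prednK //.
exact: ltnW (size_phi i).
Qed.

Lemma sum_by_phi :
  \sum_x (C x)%:~R * index_basis x
    = \sum_i \sum_(1 <= j < (ell i).+1) ev (c i j) * ev (q i j) / p%:R ^+ n i j.
Proof.
transitivity (\sum_i \sum_(y : 'I_(ell i) * 'I_(size (phi i)).-1)
    (C (existT _ i y))%:~R * index_basis (existT _ i y)).
  rewrite sig_big_dep /=; apply: eq_bigr => -[i y] _ //.
apply: eq_bigr => i _; rewrite big_add1 /= big_mkord.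
have -> (F : 'I_(ell i) * 'I_(size (phi i)).-1 -> K) : \sum_y F y = \sum_j \sum_k F (j, k).
  by rewrite pair_bigA; apply: eq_bigr => -[].
apply: eq_bigr => j _.
have -> : ev (c i j.+1) = \sum_(k < (size (phi i)).-1) (C (existT _ i (j, k)))%:~R * theta ^+ k.
  rewrite /eval_at (@horner_coef_wide _ (size (phi i)).-1); last first.
    by apply: leq_trans (size_poly _ _) _; apply: size_poly.
  by apply: eq_bigr => k _; rewrite coef_map /= coef_poly_atE.
rewrite !mulr_suml; apply: eq_bigr => k _.
rewrite /= basis_eltE ?ltn_ord //.
by move: (ev _) (_ ^-1) => x1 x2; ring.
Qed.

Definition cofactor i : {poly int} := \prod_(i' | i' != i) phi i' ^+ ell i'.

Lemma cofactor_red i : red (phi_irr i) (cofactor i) != 0.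
Proof.
rewrite (in_qfpoly_eq0 (phi_irr i)) rmorph_prod /=.
by under eq_bigr do rewrite rmorphXn /=; apply: cofactor_ndvd.
Qed.

(** Modulo f the cofactor contains phi_i'^j, which turns q_(i',j) into minus the
remainder of f by phi_i'^j.  Its coefficients have valuation greater than y_j
because the polygon decreases strictly, so p^(floor(y_j) + 1) divides it. *)
Lemma other_term_int i i' j : i' != i -> (0 < j <= ell i')%N ->
  OKloc p (ev (cofactor i) * (ev (q i' j) / p%:R ^+ n i' j) / p%:R).
Proof.
move=> ne jl; have jl' : (j <= ell i')%N by case/andP: jl.
have [v [v0 _ _ vY v_lt]] := data i'.
have low : exists b, low_part (phi i') f j = p%:R ^+ (n i' j).+1 * b.
  rewrite /low_part; elim/big_ind: _ => [|x y [bx ->] [by' ->]|s _].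
  - by exists 0; rewrite mulr0.
  - by exists (bx + by'); rewrite mulrDr.
  have [->|as0] := eqVneq (dev (phi i') f s) 0; first by exists 0; rewrite mul0r mulr0.
  have le_u : ((n i' j).+1 <= vp p (dev (phi i') f s))%N.
    rewrite -(ltr_nat rat) (le_lt_trans _ (v_lt s j _ as0)) ?ltn_ord //.
    by rewrite vY // truncn_le.
  rewrite {1}[dev _ _ _](unit_partE p_prime) -(subnKC le_u) exprD.
  by eexists; rewrite -!mulrA.
have [b Eb] := low.
have -> : ev (cofactor i) * (ev (q i' j) / p%:R ^+ n i' j) / p%:R
   = ev (- (\prod_(k | (k != i) && (k != i')) phi k ^+ ell k * phi i' ^+ (ell i' - j) * b)).
  have Ef := congr1 ev (quot_low f (phi_monic i') (size_phi i') j).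
  rewrite (ev_f theta_root) Eb rmorphD !rmorphM !rmorphXn rmorph_nat /= in Ef.
  have Eq : ev (q i' j) * ev (phi i') ^+ j = - (p%:R ^+ (n i' j).+1 * ev b).
    by apply/eqP; rewrite -addr_eq0 -Ef.
  rewrite /cofactor (bigD1 i') //= -{1}(subnK jl') exprD rmorphN !rmorphM !rmorphXn /=.
  set A := ev (\prod_(_ | _) _).
  have -> : ev (phi i') ^+ (ell i' - j) * ev (phi i') ^+ j * A * (ev (q i' j) / p%:R ^+ n i' j) / p%:R
     = ev (phi i') ^+ (ell i' - j) * A * (ev (q i' j) * ev (phi i') ^+ j) / p%:R ^+ (n i' j).+1.
    by rewrite exprSr invfM; ring.
  rewrite Eq mulrN mulNr; congr (- _).
  have : (p%:R ^+ (n i' j).+1 : K) != 0 by rewrite expf_neq0.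
  by move: (_ ^+ (n i' j).+1) (ev b) A (_ ^+ (ell i' - j)) => P x1 x2 x3 P0; field.
exact: (OKloc_ev p_prime f_monic theta_root).
Qed.

(** After multiplication by the cofactor only the terms of phi_i are left up to
p-integral elements, and [coefs_red_eq0] applies to them. *)
Lemma coef_divisible x : (p %| C x)%Z.
Proof.
case: x => i [j k]; rewrite -coef_poly_atE.
have x_int : OKloc p (\sum_(1 <= j < (ell i).+1)
    ev (cofactor i) * ev (c i j) * ev (q i j) / p%:R ^+ (n i j).+1).
  have -> : \sum_(1 <= j < (ell i).+1)
      ev (cofactor i) * ev (c i j) * ev (q i j) / p%:R ^+ (n i j).+1
    = ev (cofactor i) * ((\sum_x (C x)%:~R * index_basis x) / p%:R)
      - \sum_(i' | i' != i) \sum_(1 <= j < (ell i').+1)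
          ev (c i' j) * (ev (cofactor i) * (ev (q i' j) / p%:R ^+ n i' j) / p%:R).
    rewrite sum_by_phi (bigD1 i) //= mulrDl mulrDr !mulr_suml !mulr_sumr.
    rewrite [X in _ = _ + X - _](_ : _ = \sum_(i' | i' != i) \sum_(1 <= j < (ell i').+1)
          ev (c i' j) * (ev (cofactor i) * (ev (q i' j) / p%:R ^+ n i' j) / p%:R)).
      rewrite addrK; apply: eq_bigr => j' _; rewrite exprSr invfM.
      by move: (_ ^-1) (_^-1) (ev _) (ev _) (ev _) => x1 x2 x3 x4 x5; ring.
    apply: eq_bigr => i' _; rewrite mulr_suml mulr_sumr; apply: eq_bigr => j' _.
    by move: (_ ^-1) (_^-1) (ev _) (ev _) (ev _) => x1 x2 x3 x4 x5; ring.
  apply: OKlocD => //; first by apply: OKlocM => //; apply: (OKloc_ev p_prime f_monic theta_root).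
  apply: (OKlocN p_prime f_monic theta_root).
  apply: (OKloc_sum p_prime f_monic theta_root) => i' ne.
  rewrite big_nat; apply: (OKloc_sum p_prime f_monic theta_root) => j' jl.
  by apply: OKlocM => //; [apply: (OKloc_ev p_prime f_monic theta_root) | apply: other_term_int].
have jl : (0 < j.+1 <= ell i)%N by rewrite ltn_ord.
have := coefs_red_eq0 p_prime f_monic f_irr theta_root (phi_monic i) (f_fact_at i) (cofactor_ndvd i)
   (@f_reg i) (cofactor_red i) (size_coef_poly_at i) x_int jl.
move/eqP; rewrite (in_qfpoly_eq0 (phi_irr i)).
move/(redp_small_eq0 (phi_monic i) (size_coef_poly_at i j.+1))/polyP/(_ k).
by rewrite coef_map coef0 /= => /eqP; rewrite (intr_Fp_eq0 p_prime).
Qed.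

End Saturation.

End Assembly.

Theorem theorem2p6 (p : nat) (f : {poly int})
    (K : fieldExtType rat) (theta : K)
    (t : nat) (phi : 'I_t -> {poly int}) (ell : 'I_t -> nat)
    (p_prime : prime p)
    (f_monic : f \is monic)
    (f_irr : irreducible_poly f)
    (theta_root : root (map_poly intr f) theta)
    (K_gen : <<1; theta>>%VS = fullv)
    (phi_monic : forall i, phi i \is monic)
    (phi_irr : forall i, monic_irreducible_poly (redp p (phi i)))
    (phi_inj : injective (fun i => redp p (phi i)))
    (ell_gt0 : forall i, (0 < ell i)%N)
    (f_fact : redp p f = \prod_(i < t) redp p (phi i) ^+ ell i)
    (f_reg : p_regular f phi_irr) :
  p_integral_basis p
    (fun x : {i : 'I_t & ('I_(ell i) * 'I_(size (phi i)).-1)%type} =>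
       let: existT i (j, k) := x in
       basis_elt p f (phi i) theta j.+1 k).
Proof.
apply: p_integral_basis_of_saturated => //.
- move=> C C_int; exact: (coef_divisible p_prime f_monic f_irr theta_root phi_monic phi_inj f_fact f_reg C_int).
- exact: (dim_le_card f_monic theta_root K_gen phi_monic phi_irr f_fact).
exact: (index_basis_int p_prime f_monic f_irr theta_root phi_monic phi_irr phi_inj f_fact).
Qed.
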